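(* Let $d\ge 1$, $D=\{1,\dots,d\}$, let $B\subset D$ be non-empty and $B'=D\setminus B$. Let $L_Q(\mathbb{I}^d)$ be an Orlicz space such that $$L_Q(\mathbb{I}^d)\not\subseteq L\log^{|B|}L(\mathbb{I}^d).$$ Then: a) $$\sup_{n\ge 2}\left\Vert L_{n(B)}\circ R_{n(B')}\right\Vert_{L_Q(\mathbb{I}^d)\to L_1(\mathbb{I}^d)}=\infty;$$ b) there exists a function $f\in L_Q(\mathbb{I}^d)$ such that $(L_{n(B)}\circ R_{n(B')})(f)$ does not converge to $f$ in $L_1(\mathbb{I}^d)$-norm as $n\to\infty$.
   Context: $\mathbb{I}^d=[0,1)^d$ with Lebesgue measure; functions on $\mathbb{I}^d$ are identified with their $1$-periodic extensions in each variable. $|B|$ is the number of elements of $B$. Walsh system: $r_0(x)=1$ for $x\in[0,1/2)$, $r_0(x)=-1$ for $x\in[1/2,1)$, extended $1$-periodically; $r_n(x)=r_0(2^nx)$. $w_0=1$, and if $n=2^{m_1}+\dots+2^{m_s}$ with $m_1>\dots>m_s\ge 0$, then $w_n=r_{m_1}\cdots r_{m_s}$. For $f\in L_1(\mathbb{I}^d)$ put $\widehat f(j_1,\dots,j_d)=\int_{\mathbb{I}^d}f(\mathbf{x})\prod_{i=1}^d w_{j_i}(x_i)\,d\mathbf{x}$, and for positive integers $N_1,\dots,N_d$ define the rectangular partial sum $$S_{N_1,\dots,N_d}(f;\mathbf{x})=\sum_{j_1=0}^{N_1-1}\cdots\sum_{j_d=0}^{N_d-1}\widehat f(j_1,\dots,j_d)\prod_{i=1}^d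 w_{j_i}(x_i).$$ Mixed logarithmic means: with $l_n=\sum_{k=1}^{n-1}\frac1k$, for integers $n_1,\dots,n_d\ge2$, $$(L_{n_B}\circ R_{n_{B'}})(f;\mathbf{x})=\frac{1}{\prod_{j\in D}l_{n_j}}\sum_{i_1=1}^{n_1-1}\cdots\sum_{i_d=1}^{n_d-1}\frac{S_{N_1,\dots,N_d}(f;\mathbf{x})}{i_1i_2\cdots i_d},\qquad N_j=n_j-i_j\ (j\in B),\quad N_j=i_j\ (j\in B').$$ For a single integer $n\ge2$, $L_{n(B)}\circ R_{n(B')}$ denotes the operator $L_{n_B}\circ R_{n_{B'}}$ with $n_1=\dots=n_d=n$. Orlicz spaces: a Young function is a convex continuous even function $Q$ with $Q(0)=0$, $\lim_{u\to+\infty}Q(u)/u=+\infty$ and $\lim_{u\to0}Q(u)/u=0$. The Orlicz space $L_Q(\mathbb{I}^d)$ generated by a Young function $Q$ consists of the measurable functions with finite norm $\Vert f\Vert_{L_Q(\mathbb{I}^d)}=\inf\{k>0:\int_{\mathbb{I}^d}Q(|f|/k)\le1\}$. For $\beta>0$, $L\log^\beta L(\mathbb{I}^d)$ is the Orlicz space generated by $Q(u)=u\log^\beta(1+u)$, $u\ge0$ (extended evenly). $\Vert T\Vert_{L_Q\to L_1}$ denotes the operator norm. *)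

(* Defs.v *)
From HB Require Import structures.
From mathcomp Require Import all_boot all_order all_algebra.
From mathcomp Require Import all_classical all_reals all_analysis.
Set Implicit Arguments.
Unset Strict Implicit.
Unset Printing Implicit Defensive.
Import Order.TTheory GRing.Theory Num.Theory.
Import numFieldNormedType.Exports.
Local Open Scope classical_set_scope.
Local Open Scope ring_scope.

(* [measurableTypeR R] is [R] with the measurable structure (the Borel sets)
   carried by [lebesgue_measure]. *)
Notation tupleR R n := (n.-tuple (measurableTypeR R)).

Section lebesgue_tuple.
Variable R : realType.

Definition consp (n : nat) (p : measurableTypeR R * tupleR R n) : tupleR R n.+1 :=
  [tuple of p.1 :: p.2].

Lemma measurable_consp (n : nat) : measurable_fun setT (@consp n).
Proof. exact: measurable_cons. Qed.

Definition unconsp (n : nat) (x : tupleR R n.+1) : measurableTypeR R * tupleR R n :=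
  (thead x, [tuple of behead x]).

Lemma measurable_unconsp (n : nat) : measurable_fun setT (@unconsp n).
Proof.
apply/measurable_fun_prod; first exact: measurable_tnth.
exact: measurable_behead.
Qed.

Lemma conspK (n : nat) : cancel (@consp n) (@unconsp n).
Proof.
by move=> [a t]; rewrite /unconsp/= theadE; congr pair; exact: val_inj.
Qed.

Lemma unconspK (n : nat) : cancel (@unconsp n) (@consp n).
Proof. by move=> x; apply/val_inj => /=; rewrite [in RHS](tuple_eta x). Qed.

Section cons_measure.
Variables (n : nat) (m : {sigma_finite_measure set (tupleR R n) -> \bar R}).

Definition cons_measure : set (tupleR R n.+1) -> \bar R :=
  pushforward (@lebesgue_measure R \x m)%E (@consp n).

Let mconsp := @measurable_consp n.

Let cons_measure0 : cons_measure set0 = 0%E.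
Proof. exact: measure0. Qed.

Let cons_measure_ge0 A : (0 <= cons_measure A)%E.
Proof. exact: measure_ge0. Qed.

Let cons_measure_sigma_additive : semi_sigma_additive cons_measure.
Proof. exact: measure_semi_sigma_additive. Qed.

HB.instance Definition _ := isMeasure.Build _ _ _ cons_measure
  cons_measure0 cons_measure_ge0 cons_measure_sigma_additive.

Let cons_measure_sigma_finite : sigma_finite setT cons_measure.
Proof.
have /sigma_finiteP[F [FT ndF Foo]] := sigma_finiteT (@lebesgue_measure R).
have /sigma_finiteP[G [GT ndG Goo]] := sigma_finiteT m.
exists (fun i => @unconsp n @^-1` (F i `*` G i)).
  rewrite -preimage_bigcup -[LHS](preimage_setT (@unconsp n)); congr preimage.
  rewrite -setXTT FT GT; apply/seteqP; split => [[x y]|[x y] [k _ []]]/=.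
    move=> [[k _ Fkx] [l _ Gly]]; exists (maxn k l) => //; split => /=.
      by move: x Fkx; exact/subsetPset/ndF/leq_maxl.
    by move: y Gly; exact/subsetPset/ndG/leq_maxr.
  by move=> Fkx Gky; split; exists k.
move=> i; have [mF Fi] := Foo i; have [mG Gi] := Goo i; split.
  rewrite -[X in measurable X]setTI; apply: measurable_unconsp => //.
  exact: measurableX.
rewrite /cons_measure /pushforward -comp_preimage.
rewrite (_ : _ \o _ = id); last by apply/funext => x; exact: conspK.
by rewrite preimage_id product_measure1E// lte_mul_pinfty// ge0_fin_numE.
Qed.

HB.instance Definition _ := @Measure_isSigmaFinite.Build _ _ _
  cons_measure cons_measure_sigma_finite.

End cons_measure.

Fixpoint lebesgue_tuple (n : nat) :
    {sigma_finite_measure set (tupleR R n) -> \bar R} :=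
  if n is n'.+1 then cons_measure (lebesgue_tuple n')
  else \d_([tuple] : tupleR R 0).

Lemma measurable_box (n : nat) (A : 'I_n -> set (measurableTypeR R)) :
  (forall i, measurable (A i)) ->
  measurable [set x : tupleR R n | forall i, A i (tnth x i)].
Proof.
move=> mA; rewrite (_ : [set _ | _] =
    \bigcap_i ((@tnth n (measurableTypeR R) ^~ i) @^-1` A i)).
  apply: fin_bigcap_measurable => // i _; rewrite -[X in measurable X]setTI.
  exact: measurable_tnth.
by apply/seteqP; split => [x Ax i _|x Ax i]; exact: Ax.
Qed.

Lemma lebesgue_tuple_box (n : nat) (A : 'I_n -> set (measurableTypeR R)) :
  (forall i, measurable (A i)) ->
  lebesgue_tuple n [set x | forall i, A i (tnth x i)] =
  (\prod_(i < n) lebesgue_measure (A i))%E.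
Proof.
elim: n A => [|n IH] A mA.
  by rewrite big_ord0 /= diracE mem_set//; case.
rewrite big_ord_recl -IH//= /cons_measure /pushforward.
rewrite (_ : _ @^-1` _ = A ord0 `*`
   [set x : tupleR R n | forall i, A (lift ord0 i) (tnth x i)]).
  rewrite product_measure1E//.
  exact: (measurable_box (A := fun i => A (lift ord0 i))).
apply/seteqP; split => [[a t] At|[a t] [/= Aa At] i]/=.
  by split => [|i]; [exact: (At ord0)|have := At (lift ord0 i); rewrite tnthS].
have [->//|i0] := eqVneq i ord0.
have [j ->] : exists j, i = lift ord0 j.
  by case: (unliftP ord0 i) i0 => [j ->|->]; [exists j|rewrite eqxx].
by rewrite tnthS.
Qed.

End lebesgue_tuple.

Section walsh.
Variable R : realType.

Definition rademacher (n : nat) (x : R) : R :=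
  let y := 2 ^+ n * x in
  if y - (Num.floor y)%:~R < 2^-1 then 1 else -1.

(* [odd (n %/ 2 ^ m)] says that [2 ^ m] occurs in the binary expansion of [n];
   this forces [m < n]. *)
Definition walsh (n : nat) (x : R) : R :=
  \prod_(m < n | odd (n %/ 2 ^ m)) rademacher m x.

Variable d : nat.

Definition cube : set (tupleR R d) :=
  [set x | forall i, `[0, 1[%classic (tnth x i : R)].

Definition walshd (j : 'I_d -> nat) (x : tupleR R d) : R :=
  \prod_(i < d) walsh (j i) (tnth x i).

Definition walsh_coef (f : tupleR R d -> R) (j : 'I_d -> nat) : R :=
  \int[lebesgue_tuple R d]_(x in cube) (f x * walshd j x).

(* [j] ranges over the [j] with [0 <= j i < N i] for all [i]. *)
Definition rect_sum (N : 'I_d -> nat) (f : tupleR R d -> R)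
    (x : tupleR R d) : R :=
  \sum_(j : {dffun forall i : 'I_d, 'I_(N i)})
    walsh_coef f (fun i => j i) * walshd (fun i => j i) x.

Definition harmonic_sum (n : nat) : R := \sum_(1 <= k < n) k%:R^-1.

(* [L_{n_B} o R_{n_{B'}}], with [B'] the complement of [B]. *)
Definition mixed_log_mean (B : {set 'I_d}) (n : 'I_d -> nat)
    (f : tupleR R d -> R) (x : tupleR R d) : R :=
  (\prod_(j < d) harmonic_sum (n j))^-1 *
  \sum_(i : {dffun forall j : 'I_d, 'I_(n j)} | [forall j, (0 < i j)%N])
    rect_sum (fun j => if j \in B then (n j - i j)%N else i j) f x /
    \prod_(j < d) (i j)%:R.

Definition mixed_log_mean_diag (B : {set 'I_d}) (n : nat) :
    (tupleR R d -> R) -> tupleR R d -> R :=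
  mixed_log_mean B (fun=> n).

End walsh.
Arguments cube : clear implicits.

Section orlicz.
Variable R : realType.

Definition young_function (Q : R -> R) : Prop :=
  [/\ convex_function (E := R^o) setT Q,
      continuous Q,
      (forall u, Q (- u) = Q u) /\ Q 0 = 0,
      Q u / u @[u --> +oo] --> +oo &
      Q u / u @[u --> 0^'] --> (0 : R)].

Variable d : nat.

(* The Luxemburg norm; it is [+oo] when no [k] is admissible. *)
Definition orlicz_norm (Q : R -> R) (f : tupleR R d -> R) : \bar R :=
  ereal_inf [set k%:E | k in [set k : R | 0 < k /\
    (\int[lebesgue_tuple R d]_(x in cube R d) (Q (`|f x| / k))%:E <= 1)%E]].

Definition orlicz_space (Q : R -> R) : set (tupleR R d -> R) :=
  [set f | measurable_fun (cube R d) f /\ (orlicz_norm Q f < +oo)%E].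

Definition llog_fun (beta : R) (u : R) : R := `|u| * ln (1 + `|u|) `^ beta.

Definition llog_space (beta : R) : set (tupleR R d -> R) :=
  orlicz_space (llog_fun beta).

Definition L1_norm (f : tupleR R d -> R) : \bar R :=
  (\int[lebesgue_tuple R d]_(x in cube R d) `|f x|%:E)%E.

Definition op_norm (Q : R -> R)
    (T : (tupleR R d -> R) -> tupleR R d -> R) : \bar R :=
  ereal_sup [set L1_norm (T f) | f in
    [set f | orlicz_space Q f /\ (orlicz_norm Q f <= 1)%E]].

End orlicz.
Arguments orlicz_space {R} d Q _.
Arguments llog_space {R} d beta _.

(* Main.v *)
Require Import Defs.
From mathcomp Require Import all_boot all_order all_algebra.
From mathcomp Require Import all_classical all_reals all_analysis.
From mathcomp Require Import measurable_realfun zify ring lra.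
Set Implicit Arguments.
Unset Strict Implicit.
Unset Printing Implicit Defensive.
Import Order.TTheory GRing.Theory Num.Theory.
Import numFieldNormedType.Exports.
Local Open Scope classical_set_scope.
Local Open Scope ring_scope.

(**
Write b = |B|, and let D_A(x) be the product over i in B of the Dirichlet kernels
sum_{j < 4^A} w_j(x_i). It takes the value t = 4^(A b) on a set of measure 1/t and
0 elsewhere, so the integral of Q(c D_A) is Q(c t) / t.

For n = 1 + 4 + ... + 4^(A-1) we have a Walsh polynomial phi with |phi| <= 1,
with nonnegative coefficients below n, and whose integral against the Noerlund
logarithmic kernel of order n is at least A / 128. Testing L_n(B) o R_n(B') f with
the tensor power of phi in the variables of B bounds its L_1 norm below by
c (A / 128)^b as soon as every Walsh coefficient of f is at least c times that of
D_A (the Riesz means of constants are trivial).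

If L_Q is not contained in L log^b L, then for every M > 0 there are arbitrarily
large A with Q(M t / A^b) <= t: otherwise Q(u) would dominate u log^b(1 + u). The
function M A^-b D_A then lies in the unit ball of L_Q, and its image has L_1 norm
at least M / 128^b, which is a). For b), sum 2^-(l+1) c_l D_(A_l) with
c_l = 4^(l+1) / A_l^b and A_l >= 4^(l+1): the Walsh coefficients are nonnegative,
so each term alone bounds the L_1 norms of the means from below, and these are
unbounded.
*)

(** * Walsh functions on dyadic intervals *)

Lemma sum_dyadicS (V : zmodType) (F : nat -> V) k :
  \sum_(j < 2 ^ k.+1) F j =
  \sum_(j < 2 ^ k) F j + \sum_(j < 2 ^ k) F (2 ^ k + j)%N.
Proof. by rewrite expnS mul2n -addnn big_split_ord. Qed.

Lemma odd_divn_addexp m s j : (s < m)%N ->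
  odd ((2 ^ m + j) %/ 2 ^ s) = odd (j %/ 2 ^ s).
Proof.
move=> sm; rewrite divnDl ?dvdn_exp2l 1?ltnW//.
by rewrite -expnB 1?ltnW// oddD oddX subn_eq0 leqNgt sm.
Qed.

Lemma eq_bits k i j : (i < 2 ^ k)%N -> (j < 2 ^ k)%N ->
  (forall m, (m < k)%N -> odd (i %/ 2 ^ m) = odd (j %/ 2 ^ m)) -> i = j.
Proof.
elim: k i j => [|k IH] i j ik jk ij.
  by move: ik jk; rewrite expn0 !ltnS !leqn0 => /eqP-> /eqP->.
rewrite -(odd_double_half i) -(odd_double_half j).
have := ij 0%N isT; rewrite expn0 !divn1 => ->; congr (_ + _.*2)%N.
apply: IH => [||m mk].
- by rewrite ltn_half_double -mul2n -expnS.
- by rewrite ltn_half_double -mul2n -expnS.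
- by have := ij m.+1 mk; rewrite expnS !divnMA !divn2.
Qed.

Section walsh_dyadic.
Variable R : realType.
Implicit Types (x : R) (k m n p : nat).

Lemma rademacherE m x : rademacher m x = 1 \/ rademacher m x = -1.
Proof. by rewrite /rademacher; case: ifP => _; [left|right]. Qed.

(** Up to its integer part, [x] agrees with $p/2^k$ in its first [k] binary places, so the digit of
    [x] of weight $2^{-(m+1)}$ is the digit of [p] of weight $2^{k-m-1}$. *)
Lemma rademacher_cell k p m x : (m < k)%N ->
  p%:R / 2 ^+ k <= x < p.+1%:R / 2 ^+ k ->
  rademacher m x = (-1) ^+ odd (p %/ 2 ^ (k - m.+1)).
Proof.
move=> mk; have k0 : (0 : R) < 2 ^+ k by rewrite exprn_gt0.
rewrite ler_pdivrMr// ltr_pdivlMr// => /andP[px xp].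
set c := (2 ^ (k - m.+1))%N.
have c0 : (0 < c)%N by rewrite expn_gt0.
have c0R : (0 : R) < c%:R by rewrite ltr0n.
have kE : (2 : R) ^+ k = 2 ^+ m * 2 * c%:R.
  by rewrite /c natrX -exprSr -exprD subnKC.
set q := (p %/ c)%N.
have qp : (q * c <= p)%N by rewrite leq_divM.
have pq : (p.+1 <= q.+1 * c)%N by rewrite -ltn_divLR.
have lo : q%:R <= 2 * (2 ^+ m * x).
  rewrite -(ler_pM2r c0R) -natrM (le_trans _ (le_trans px _)) ?ler_nat//.
  by rewrite kE; rewrite le_eqVlt; apply/orP; left; apply/eqP; ring.
have hi : 2 * (2 ^+ m * x) < q.+1%:R.
  rewrite -(ltr_pM2r c0R) -natrM (lt_le_trans _ (_ : p.+1%:R <= _)) ?ler_nat//.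
  by apply: le_lt_trans xp; rewrite kE; rewrite le_eqVlt; apply/orP; left; apply/eqP; ring.
rewrite /rademacher /=; set y := 2 ^+ m * x in lo hi *.
have qE := odd_double_half q.
have qER : q%:R = (odd q)%:R + 2 * (q./2)%:R :> R.
  by rewrite -natrM -natrD mul2n qE.
have fl : Num.floor y = Posz q./2.
  apply: floor_def; rewrite !intrD -!pmulrn /=.
  rewrite -(natr1 q) qER in hi; rewrite qER in lo.
  by case: (odd q) lo hi => /= lo hi; apply/andP; split; lra.
rewrite fl -pmulrn; rewrite -(natr1 q) qER in hi; rewrite qER in lo.
case: (odd q) lo hi => /= lo hi.
  by rewrite expr1 ifF//; apply/negbTE; rewrite -leNgt; lra.
by rewrite expr0 ifT//; lra.
Qed.

(** As [p] runs over the numbers with [k] bits, its digits run over all sign vectors, so the sum of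
    products factors. The induction splits off the leading digit of [p], which belongs to
    [m = 0]. *)
Lemma sum_sign_prod k (g : nat -> R -> R) :
  \sum_(p < 2 ^ k) \prod_(m < k) g m ((-1) ^+ odd (p %/ 2 ^ (k - m.+1))) =
  \prod_(m < k) (g m 1 + g m (-1)).
Proof.
elim: k g => [|k IH] g; first by rewrite big_ord_recl !big_ord0 addr0.
rewrite (sum_dyadicS (fun p => \prod_(m < k.+1)
  g m ((-1) ^+ odd (p %/ 2 ^ (k.+1 - m.+1)))) k).
rewrite [RHS]big_ord_recl -(IH (fun m => g m.+1)) mulrDl !mulr_sumr.
congr (_ + _); apply: eq_bigr => p _; rewrite big_ord_recl subn1 /=; congr (_ * _).
- by rewrite divn_small// expr0.
- by rewrite divnDl// divnn expn_gt0 /= divn_small// expr1.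
- apply: eq_bigr => m _; rewrite /bump /= add1n subSS.
  by rewrite odd_divn_addexp//; have := ltn_ord m; lia.
Qed.

(** The digits of [n] from place [k] on vanish. With the common range [m < k], Walsh functions of
    different indices can be multiplied factor by factor. *)
Lemma walshE k n x : (n < 2 ^ k)%N ->
  walsh n x = \prod_(m < k) (if odd (n %/ 2 ^ m) then rademacher m x else 1).
Proof.
have widen a b : (a <= b)%N -> (n < 2 ^ a)%N ->
    \prod_(m < b) (if odd (n %/ 2 ^ m) then rademacher m x else 1) =
    \prod_(m < a) (if odd (n %/ 2 ^ m) then rademacher m x else 1).
  move=> ab na; rewrite -(subnKC ab) big_split_ord /= [X in _ * X]big1 ?mulr1//.
  move=> i _; rewrite divn_small//.
  by rewrite (leq_trans na)// leq_pexp2l// leq_addr.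
move=> nk; rewrite /walsh big_mkcond -(widen n (maxn n k)) ?leq_maxl//; last first.
  by rewrite ltn_expl.
by rewrite (widen k)// leq_maxr.
Qed.

Lemma walsh0 x : walsh 0 x = 1.
Proof. by rewrite /walsh big_ord0. Qed.

Lemma norm_walsh n x : `|walsh n x| = 1.
Proof.
rewrite /walsh; elim/big_ind: _ => [|a b a1 b1|m _]; rewrite ?normr1//.
- by rewrite normrM a1 b1 mulr1.
- by case: (rademacherE m x) => ->; rewrite ?normrN normr1.
Qed.

Lemma walsh_addexp m j x : (j < 2 ^ m)%N ->
  walsh (2 ^ m + j) x = rademacher m x * walsh j x.
Proof.
move=> jm; rewrite (walshE (k := m.+1)); last first.
  by rewrite expnS mul2n -addnn ltn_add2l.
rewrite big_ord_recr /= divnDl// divnn expn_gt0 /= divn_small// addn0 mulrC.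
rewrite (walshE _ jm); congr (_ * _); apply: eq_bigr => i _.
by rewrite odd_divn_addexp.
Qed.

Lemma walsh_dirichlet m x :
  \sum_(j < 2 ^ m) walsh j x = \prod_(s < m) (1 + rademacher s x).
Proof.
elim: m => [|m IH]; first by rewrite big_ord_recl !big_ord0 addr0 walsh0.
rewrite (sum_dyadicS (fun j => walsh j x)) big_ord_recr /= -IH mulrDr mulr1.
congr (_ + _); rewrite mulr_suml; apply: eq_bigr => j _.
by rewrite walsh_addexp// mulrC.
Qed.

Lemma walsh_cell k n p x : (n < 2 ^ k)%N ->
  p%:R / 2 ^+ k <= x < p.+1%:R / 2 ^+ k ->
  walsh n x =
  \prod_(m < k) (if odd (n %/ 2 ^ m) then
                   (-1) ^+ odd (p %/ 2 ^ (k - m.+1)) else 1).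
Proof.
move=> nk xp; rewrite (walshE _ nk); apply: eq_bigr => m _.
by case: ifP => // _; exact: rademacher_cell.
Qed.

Lemma node_cell k p : p%:R / 2 ^+ k <= (p%:R / 2 ^+ k : R) < p.+1%:R / 2 ^+ k.
Proof. by rewrite lexx /= ltr_pM2r ?ltr_nat// invr_gt0 exprn_gt0. Qed.

(** By [sum_sign_prod] the sum becomes a product over binary places, and a place where [i] and [j]
    differ contributes the factor $1 + (-1) = 0$. *)
Lemma walsh_orthogonal k i j : (i < 2 ^ k)%N -> (j < 2 ^ k)%N ->
  \sum_(p < 2 ^ k) walsh i (p%:R / 2 ^+ k) * walsh j (p%:R / 2 ^+ k) =
  (if i == j then 2 ^+ k else 0) :> R.
Proof.
move=> ik jk; pose g m (s : R) := (if odd (i %/ 2 ^ m) then s else 1) *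
  (if odd (j %/ 2 ^ m) then s else 1).
transitivity (\sum_(p < 2 ^ k)
    \prod_(m < k) g m ((-1) ^+ odd (p %/ 2 ^ (k - m.+1)))).
  apply: eq_bigr => p _; rewrite !(walsh_cell _ (node_cell k p))//.
  by rewrite -big_split.
rewrite sum_sign_prod; case: eqP => [ij|ij].
  rewrite (eq_bigr (fun=> 2)) ?prodr_const ?card_ord// => m _.
  by rewrite /g -ij; case: ifP => _; rewrite ?mulrNN ?mulr1.
have [m mij] : exists m : 'I_k, odd (i %/ 2 ^ m) != odd (j %/ 2 ^ m).
  apply/existsP; apply: contra_notT ij; rewrite negb_exists => /forallP ij.
  apply: (eq_bits ik jk) => m mk; apply/eqP.
  by have := ij (Ordinal mk); rewrite negbK.
rewrite (bigD1 m)//= [X in X * _](_ : _ = 0) ?mul0r// /g.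
by case: (odd _) (odd _) mij => -[]//= _; rewrite ?mulr1 ?mul1r subrr.
Qed.

End walsh_dyadic.

(** * Oscillation of the logarithmic kernels *)

(* [osc_index A] is 1 + 4 + ... + 4^(A-1): its binary digits alternate, which
   makes the Noerlund logarithmic kernel of this order large in L_1. *)
Fixpoint osc_index (A : nat) : nat :=
  if A is A'.+1 then (2 ^ A'.*2 + osc_index A')%N else 0%N.

Lemma osc_index_lt A : (osc_index A < 2 ^ A.*2)%N.
Proof. by elim: A => //= A IH; rewrite doubleS !expnS; lia. Qed.

Lemma osc_index_ge A : (2 ^ A.*2 <= osc_index A.+1)%N.
Proof. exact: leq_addr. Qed.

Lemma osc_index_gt A : (A < osc_index A.+1)%N.
Proof.
apply: leq_trans (osc_index_ge A); apply: (leq_trans (ltn_expl A (ltnSn 1))).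
by rewrite leq_exp2l// -addnn leq_addr.
Qed.

Lemma osc_index_ge2 A : (2 <= A)%N -> (2 <= osc_index A)%N.
Proof. by case: A => // A A2; apply: leq_trans (osc_index_gt A); lia. Qed.

(** * Dyadic bounds for harmonic sums *)

Section harmonic_sum_bounds.
Variable R : realType.

Lemma harmonic_block p :
  2^-1 <= \sum_(2 ^ p <= k < 2 ^ p.+1) (k%:R^-1 : R) <= 1.
Proof.
have p0 : (0 : R) < (2 ^ p)%:R by rewrite ltr0n expn_gt0.
have cnt (c : R) : \sum_(2 ^ p <= k < 2 ^ p.+1) c = (2 ^ p)%:R * c.
  by rewrite sumr_const_nat expnS mul2n -addnn addnK mulr_natl.
apply/andP; split.
- have -> : (2^-1 : R) = (2 ^ p)%:R * ((2 ^ p.+1)%:R)^-1.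
    by rewrite !natrX exprS; field; rewrite expf_neq0.
  rewrite -cnt; apply: ler_sum_nat => k /andP[k1 k2].
  have kp : (0 < k)%N by apply: leq_trans k1; rewrite expn_gt0.
  by rewrite lef_pV2 ?posrE ?ltr0n ?expn_gt0// ler_nat ltnW.
- rewrite -[leRHS](mulfV (lt0r_neq0 p0)) -cnt; apply: ler_sum_nat => k /andP[k1 k2].
  have kp : (0 < k)%N by apply: leq_trans k1; rewrite expn_gt0.
  by rewrite lef_pV2 ?posrE ?ltr0n ?expn_gt0// ler_nat.
Qed.

Lemma harmonic_sum_exp2 p : p%:R / 2 <= harmonic_sum R (2 ^ p) <= p%:R.
Proof.
elim: p => [|p IH]; first by rewrite /harmonic_sum expn0 big_geq// mul0r lexx.
have := harmonic_block p; move: IH.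
rewrite /harmonic_sum (@big_cat_nat _ _ _ (2 ^ p)%N 1%N (2 ^ p.+1)%N)/= ?expn_gt0//.
  by rewrite -(natr1 p) => /andP[? ?] /andP[? ?]; apply/andP; split; lra.
by rewrite leq_exp2l.
Qed.

Lemma le_harmonic_sum m n : (m <= n)%N -> harmonic_sum R m <= harmonic_sum R n.
Proof.
move=> mn; rewrite /harmonic_sum (big_nat_widen _ _ n)// big_mkcond /=.
by apply: ler_sum => i _; case: ifP => // _; rewrite invr_ge0.
Qed.

Lemma harmonic_sum_gt0 n : (2 <= n)%N -> 0 < harmonic_sum R n.
Proof.
move=> n2; apply: lt_le_trans (le_harmonic_sum n2).
by rewrite /harmonic_sum big_nat1 invr1.
Qed.

End harmonic_sum_bounds.

(** * A bounded Walsh polynomial that detects the size of the Noerlund logarithmic kernel *)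

Section test_function.
Variable R : realType.
Implicit Types (x : R) (A j : nat).

(* On [4^-(i+1), 2 * 4^-(i+1)[ the test function is the Walsh function whose
   index consists of the digits of [osc_index A] above 4^i; elsewhere it is 0.
   Only indices [j < 4^A] matter. *)
Fixpoint test_coef A j : R :=
  if A is A'.+1 then
    (if (j < 2 ^ A'.*2.+1)%N then 1 else -1) / 2 ^+ A'.*2.+2 +
    (if (2 ^ A'.*2 <= j < 2 ^ A'.*2.+1)%N
     then test_coef A' (j - 2 ^ A'.*2) else 0)
  else 0.

Definition test_fun A x : R := \sum_(j < 2 ^ A.*2) test_coef A j * walsh j x.

(** The first term shifts every index by $4^A$; the second is the indicator of $[4^{-(A+1)}, 2 \cdot
    4^{-(A+1)}[$, extended periodically. They come from the two summands of [test_coef]. *)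
Lemma test_funS A x : test_fun A.+1 x =
  rademacher A.*2 x * test_fun A x +
  (\prod_(s < A.*2.+1) ((1 + rademacher s x) / 2)) *
  ((1 - rademacher A.*2.+1 x) / 2).
Proof.
set e := A.*2; have e0 : (2 : R) ^+ e.+2 != 0 by rewrite expf_neq0.
rewrite /test_fun doubleS -/e.
under eq_bigr do rewrite /= mulrDl.
rewrite big_split /= addrC; congr (_ + _).
- rewrite (sum_dyadicS (fun j => (if (2 ^ e <= j < 2 ^ e.+1)%N then
     test_coef A (j - 2 ^ e) else 0) * walsh j x)) [X in _ + X]big1 ?addr0.
    rewrite (sum_dyadicS (fun j => (if (2 ^ e <= j < 2 ^ e.+1)%N then
      test_coef A (j - 2 ^ e) else 0) * walsh j x)) big1 ?add0r.
      rewrite mulr_sumr; apply: eq_bigr => j _.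
      rewrite leq_addr addKn expnS mul2n -addnn ltn_add2l ltn_ord /=.
      by rewrite walsh_addexp// mulrCA.
    by move=> j _; rewrite leqNgt ltn_ord/= mul0r.
  by move=> j _; rewrite [X in _ && X]ltnNge leq_addr andbF mul0r.
- transitivity ((\sum_(j < 2 ^ e.+1) walsh j x) * (1 - rademacher e.+1 x) /
                2 ^+ e.+2).
    rewrite (sum_dyadicS (fun j => (if (j < 2 ^ e.+1)%N then 1 else -1) /
      2 ^+ e.+2 * walsh j x)) mulrBr mulr1 mulrBl; congr (_ + _).
      by rewrite mulr_suml; apply: eq_bigr => j _; rewrite ltn_ord mul1r mulrC.
    rewrite mulr_suml mulr_suml -sumrN; apply: eq_bigr => j _.
    by rewrite ltnNge leq_addr /= walsh_addexp//; field.
  rewrite walsh_dirichlet big_split /= prodr_const card_ord exprVn.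
  by rewrite (exprS _ e.+1); field; rewrite expf_neq0.
Qed.

(** The product is the indicator of $[0, 4^{-A}[$, extended periodically. The bound by 1 alone does
    not pass through the induction: the bump added at the next step lies in this interval, so the
    function has to vanish there beforehand. *)
Lemma test_fun_bound A x :
  `|test_fun A x| <= 1 - \prod_(s < A.*2) ((1 + rademacher s x) / 2).
Proof.
elim: A => [|A IH].
  rewrite /test_fun /= big_ord0 subrr big1 ?normr0// => j _.
  by rewrite mul0r.
rewrite test_funS doubleS; set e := A.*2.
have r1 m : `|rademacher m x : R| = 1.
  by case: (rademacherE m x) => ->; rewrite ?normrN normr1.
set P := \prod_(s < e) _ in IH *.
have P0 : 0 <= P.
  apply: prodr_ge0 => s _; rewrite divr_ge0// -lerBlDl sub0r.
  by have := r1 s; case: (rademacherE s x) => -> _; lra.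
rewrite !big_ord_recr /= -/P.
apply: le_trans (ler_normD _ _) _; rewrite normrM r1 mul1r.
move: IH; set T := `|test_fun A x|.
case: (rademacherE e x) => ->; case: (rademacherE e.+1 x) => ->.
- rewrite (_ : (1 - 1) / 2 = 0) ?mulr0 ?normr0; last by lra.
  by move=> TP; lra.
- rewrite (_ : (1 + 1) / 2 = 1); last by lra.
  rewrite (_ : (1 - -1) / 2 = 1); last by lra.
  by rewrite !mulr1 ger0_norm// => TP; lra.
- by rewrite subrr !mul0r !mulr0 ?mul0r normr0 => TP; lra.
- by rewrite subrr !mul0r !mulr0 ?mul0r normr0 => TP; lra.
Qed.

Lemma norm_test_fun A x : `|test_fun A x| <= 1.
Proof.
apply: le_trans (test_fun_bound A x) _; rewrite gerBl; apply: prodr_ge0 => s _.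
by rewrite divr_ge0//; case: (rademacherE s x) => ->; lra.
Qed.

(** Since [osc_index A.+1] is less than $2^{2A+1}$, only the half of the coefficients where the new
    bump has the sign $+1$ is reached. This is what keeps the coefficients in use nonnegative. *)
Lemma test_coefS A j : (j < osc_index A.+1)%N ->
  test_coef A.+1 j = 2 ^- A.*2.+2 +
    if (2 ^ A.*2 <= j)%N then test_coef A (j - 2 ^ A.*2) else 0.
Proof.
move=> jA; have jlt : (j < 2 ^ A.*2.+1)%N.
  by apply: leq_trans jA _; have := osc_index_lt A; rewrite /= expnS; lia.
by rewrite /= jlt andbT mul1r.
Qed.

Lemma test_coef_ge0 A j : (j < osc_index A)%N -> 0 <= test_coef A j.
Proof.
elim: A j => [//|A IH] j jA; rewrite test_coefS// addr_ge0 ?invr_ge0 ?exprn_ge0//.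
case: ifP => // Aj; apply: IH; rewrite ltn_subLR//.
Qed.

(* The integral of the test function against the unnormalised kernel of order
   [osc_index A]. *)
Definition norlund_sum A : R :=
  \sum_(1 <= i < osc_index A) i%:R^-1 * \sum_(j < osc_index A - i) test_coef A j.

(** The constant part of [test_coefS] is counted [osc_index A.+1 - i] times. The shifted part gives
    back the inner sum of order [osc_index A], and is empty once [i >= osc_index A]. *)
Lemma norlund_sumS A : norlund_sum A.+1 = norlund_sum A +
  2 ^- A.*2.+2 * \sum_(1 <= i < osc_index A.+1) (osc_index A.+1 - i)%:R / i%:R.
Proof.
rewrite [in RHS]/norlund_sum (big_nat_widen _ _ (osc_index A.+1)) ?leq_addl//.
rewrite big_mkcond mulr_sumr -big_split; apply: eq_big_nat => i /andP[i1 iN].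
rewrite (eq_bigr (fun j : 'I__ => 2 ^- A.*2.+2 +
    if (2 ^ A.*2 <= j)%N then test_coef A (j - 2 ^ A.*2) else 0)); last first.
  move=> j _; rewrite test_coefS//.
  by apply: leq_trans (ltn_ord j) _; rewrite leq_subr.
rewrite big_split /= sumr_const card_ord mulrDr [LHS]addrC; congr (_ + _); last first.
  by rewrite -[X in _ * X]mulr_natl mulrCA mulrA mulrC.
case: ifP => iA.
  congr (_ * _); rewrite -addnBA 1?ltnW// big_split_ord /= big1 ?add0r.
    by apply: eq_bigr => j _; rewrite leq_addr addKn.
  by move=> j _; rewrite leqNgt ltn_ord.
rewrite big1 ?mulr0// => j _; rewrite leqNgt ifF//; apply/negbTE.
by rewrite negbK; have := ltn_ord j; move: iA; rewrite ltnNge => /negbFE; lia.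
Qed.

(** Passing from [A] to [A+1] adds at least $A/16$. For $A \ge 1$ and $i < 2^{2A-1}$ the factor $n -
    i$, with [n = osc_index A.+1], is at least $2^{2A-1}$, and the harmonic sum over these [i] is at
    least $(2A-1)/2$. *)
Lemma norlund_sum_ge A : A%:R * (A%:R - 1) / 32 <= norlund_sum A.
Proof.
elim: A => [|A IH]; first by rewrite /norlund_sum big_geq// !mul0r.
rewrite norlund_sumS -(natr1 A).
suff : A%:R / 16 <= (2 : R) ^- A.*2.+2 *
    \sum_(1 <= i < osc_index A.+1) (osc_index A.+1 - i)%:R / i%:R by lra.
case: A {IH} => [|A].
  by rewrite mul0r mulr_ge0 ?invr_ge0 ?exprn_ge0//; apply: sumr_ge0.
set N := osc_index A.+2; have NA : (2 ^ A.+1.*2 <= N)%N := osc_index_ge A.+1.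
set e := A.*2.+1; have eE : A.+1.*2 = e.+1 by [].
rewrite eE in NA *.
have := harmonic_sum_exp2 R e => /andP[he _].
apply: (@le_trans _ _ (2 ^- e.+3 * (2 ^+ e * harmonic_sum R (2 ^ e)))).
  have -> : (2 : R) ^- e.+3 * (2 ^+ e * harmonic_sum R (2 ^ e)) =
      harmonic_sum R (2 ^ e) / 8.
    by rewrite !exprS; field; rewrite expf_neq0.
  have : e%:R = 2 * A%:R + 1 :> R by rewrite /e -mul2n -natr1 natrM.
  rewrite -(natr1 A); have : (0 : R) <= A%:R by [].
  by move=> ? ?; lra.
rewrite ler_pM2l ?invr_gt0 ?exprn_gt0// /harmonic_sum mulr_sumr.
rewrite expnS in NA.
rewrite (big_nat_widen _ _ N); last by lia.
rewrite big_mkcond /=; apply: ler_sum_nat => i /andP[i1 iN].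
case: ifP => ie; last by rewrite divr_ge0.
by rewrite ler_pM2r ?invr_gt0 ?ltr0n// -natrX ler_nat; lia.
Qed.

(** The normalising factor is at most $2A$ because [osc_index A] is below $4^A$, while $A(A-1)/32
    \ge A^2/64$ for $A \ge 2$. *)
Lemma norlund_mean_ge A : (2 <= A)%N ->
  A%:R / 128 <= (harmonic_sum R (osc_index A))^-1 * norlund_sum A.
Proof.
move=> A2; have := norlund_sum_ge A.
have l0 : 0 < harmonic_sum R (osc_index A).
  exact/harmonic_sum_gt0/osc_index_ge2.
have lA : harmonic_sum R (osc_index A) <= 2 * A%:R.
  apply: le_trans (le_harmonic_sum R (ltnW (osc_index_lt A))) _.
  have /andP[_] := harmonic_sum_exp2 R A.*2.
  by rewrite -mul2n natrM.
have A1 : (2 : R) <= A%:R by rewrite ler_nat.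
move=> hV; rewrite [leRHS]mulrC ler_pdivlMr//; apply: le_trans hV.
apply: (@le_trans _ _ (A%:R / 128 * (2 * A%:R))); first by rewrite ler_wpM2l.
by nra.
Qed.

End test_function.

(** * Dyadic step functions on the cube *)

Section dyadic_step.
Variables (R : realType) (d : nat).
Implicit Types (k : nat) (x : tupleR R d) (G : tupleR R d -> R).

Lemma measurable_cube : measurable (cube R d).
Proof.
exact: (measurable_box (A := fun=> (`[0, 1[%classic : set (measurableTypeR R)))).
Qed.

Lemma cube_measure : lebesgue_tuple R d (cube R d) = 1%E.
Proof.
rewrite (lebesgue_tuple_box
  (A := fun=> (`[0, 1[%classic : set (measurableTypeR R))))//.
by rewrite big1// => i _; rewrite lebesgue_measure_itv/= lte_fin ltr01 oppr0 adde0.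
Qed.

Definition dyadic_cell k (p : 'I_d -> 'I_(2 ^ k)) : set (tupleR R d) :=
  [set x | forall i, `[(p i)%:R / 2 ^+ k, (p i).+1%:R / 2 ^+ k[%classic
                       (tnth x i : R)].

Definition dyadic_node k (p : 'I_d -> 'I_(2 ^ k)) : tupleR R d :=
  [tuple (p i)%:R / 2 ^+ k : R | i < d].

(** For these functions an integral over the cube is a finite sum over the lower corners of the
    cells, which takes the place of iterated integration. *)
Definition dyadic_step k G :=
  forall (p : {ffun 'I_d -> 'I_(2 ^ k)}) x,
    dyadic_cell p x -> G x = G (dyadic_node p).

Lemma measurable_dyadic_cell k (p : 'I_d -> 'I_(2 ^ k)) :
  measurable (dyadic_cell p).
Proof.
exact: (measurable_box (A := fun i => (`[(p i)%:R / 2 ^+ k,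
  (p i).+1%:R / 2 ^+ k[%classic : set (measurableTypeR R)))).
Qed.

Lemma dyadic_cell_measure k (p : 'I_d -> 'I_(2 ^ k)) :
  lebesgue_tuple R d (dyadic_cell p) = ((2 ^- k) ^+ d)%:E.
Proof.
rewrite (lebesgue_tuple_box (A := fun i => (`[(p i)%:R / 2 ^+ k,
  (p i).+1%:R / 2 ^+ k[%classic : set (measurableTypeR R))))//.
rewrite (eq_bigr (fun=> (2 ^- k)%:E)) => [|i _].
  by rewrite prodEFin prodr_const card_ord.
rewrite lebesgue_measure_itv/= lte_fin ltr_pM2r ?invr_gt0 ?exprn_gt0//.
by rewrite ltr_nat ltnSn -EFinB -mulrBl -natr1 addrAC subrr add0r mul1r.
Qed.

Lemma dyadic_cell_cube k (p : 'I_d -> 'I_(2 ^ k)) : dyadic_cell p `<=` cube R d.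
Proof.
move=> x px i; have := px i; rewrite /= !in_itv /= => /andP[x0 x1].
rewrite (le_trans _ x0) ?divr_ge0 ?exprn_ge0//= (lt_le_trans x1)//.
by rewrite ler_pdivrMr ?exprn_gt0// mul1r -natrX ler_nat.
Qed.

Lemma dyadic_node_cell k (p : 'I_d -> 'I_(2 ^ k)) :
  dyadic_cell p (dyadic_node p).
Proof. by move=> i; rewrite /= tnth_mktuple in_itv /=; exact: node_cell. Qed.

Lemma dyadic_cell_inj k (p q : {ffun 'I_d -> 'I_(2 ^ k)}) x :
  dyadic_cell p x -> dyadic_cell q x -> p = q.
Proof.
have k0 : (0 : R) < 2 ^+ k by rewrite exprn_gt0.
move=> px qx; apply/ffunP => i; apply/val_inj/eqP => /=.
have := px i; have := qx i; rewrite /= !in_itv /=.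
rewrite !ler_pdivrMr// !ltr_pdivlMr// => /andP[a b] /andP[c e].
have := le_lt_trans a e; have := le_lt_trans c b.
by rewrite !ltr_nat !ltnS eqn_leq => -> ->.
Qed.

Lemma cube_dyadic_cell k x : cube R d x ->
  exists p : {ffun 'I_d -> 'I_(2 ^ k)}, dyadic_cell p x.
Proof.
have k0 : (0 : R) < 2 ^+ k by rewrite exprn_gt0.
move=> cx.
have h i : (Num.trunc (2 ^+ k * (tnth x i : R)) < 2 ^ k)%N.
  have /= := cx i; rewrite in_itv /= => /andP[x0 x1].
  rewrite -(ltr_nat R) natrX.
  have /andP[+ _] := @truncn_itv R (2 ^+ k * (tnth x i : R)) ltac:(by rewrite mulr_ge0// ltW).
  by move/le_lt_trans; apply; rewrite gtr_pMr.
exists [ffun i => Ordinal (h i)] => i; rewrite /= ffunE in_itv /=.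
have /= := cx i; rewrite in_itv /= => /andP[x0 x1].
have := @truncn_itv R (2 ^+ k * (tnth x i : R)) ltac:(by rewrite mulr_ge0// ltW).
by rewrite ler_pdivrMr// ltr_pdivlMr// mulrC.
Qed.

Lemma dyadic_step_indic k G x : dyadic_step k G -> cube R d x ->
  G x = \sum_(p : {ffun 'I_d -> 'I_(2 ^ k)})
          G (dyadic_node p) * \1_(dyadic_cell p) x.
Proof.
move=> stG /(cube_dyadic_cell k)[p px]; rewrite (bigD1 p)//= indicE mem_set//.
rewrite mulr1 big1 ?addr0 ?(stG p)// => q qp; rewrite indicE memNset ?mulr0//.
by move=> qx; move/eqP: qp; apply; exact: dyadic_cell_inj qx px.
Qed.

Lemma measurable_dyadic_step k G : dyadic_step k G ->
  measurable_fun (cube R d) G.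
Proof.
move=> stG; apply: (eq_measurable_fun (fun x =>
  \sum_(p : {ffun 'I_d -> 'I_(2 ^ k)}) G (dyadic_node p) * \1_(dyadic_cell p) x)).
  by move=> x; rewrite inE => cx; rewrite -dyadic_step_indic.
apply: measurable_sum => p; apply: measurable_funM => //.
by apply: measurable_indic; exact: measurable_dyadic_cell.
Qed.

Lemma integral_dyadic_step k G : dyadic_step k G ->
  (\int[lebesgue_tuple R d]_(x in cube R d) (G x)%:E)%E =
  ((2 ^- k) ^+ d *
   \sum_(p : {ffun 'I_d -> 'I_(2 ^ k)}) G (dyadic_node p))%:E.
Proof.
move=> stG; have mC := measurable_cube.
transitivity (\int[lebesgue_tuple R d]_(x in cube R d)
    \sum_(p : {ffun 'I_d -> 'I_(2 ^ k)})
      ((G (dyadic_node p))%:E * (\1_(dyadic_cell p) x)%:E))%E.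
  apply: eq_integral => x; rewrite inE => cx.
  by rewrite (dyadic_step_indic stG cx) -sumEFin.
have cellE (p : {ffun 'I_d -> 'I_(2 ^ k)}) : (\int[lebesgue_tuple R d]_(x in cube R d)
    (\1_(dyadic_cell p) x)%:E)%E = ((2 ^- k) ^+ d)%:E.
  rewrite integral_indic//; last exact: measurable_dyadic_cell.
  rewrite setIidl; last exact: dyadic_cell_cube.
  exact: dyadic_cell_measure.
have int1 (p : {ffun 'I_d -> 'I_(2 ^ k)}) : (lebesgue_tuple R d).-integrable
    (cube R d) (fun x => (\1_(dyadic_cell p) x)%:E).
  apply/integrableP; split.
    apply/measurable_EFinP; apply: measurable_indic.
    exact: measurable_dyadic_cell.
  under eq_integral do rewrite gee0_abs ?lee_fin//.
  by rewrite cellE ltry.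
rewrite integral_sum//; last by move=> p; exact: integrableZl.
rewrite mulr_sumr -sumEFin; apply: eq_bigr => p _.
by rewrite integralZl// cellE -EFinM mulrC.
Qed.

Lemma dyadic_step_comp k (h : R -> R) G : dyadic_step k G ->
  dyadic_step k (fun x => h (G x)).
Proof. by move=> stG p x /stG ->. Qed.

Lemma dyadic_stepM k G H : dyadic_step k G -> dyadic_step k H ->
  dyadic_step k (fun x => G x * H x).
Proof. by move=> stG stH p x px; rewrite (stG p)// (stH p). Qed.

Lemma dyadic_step_sum k (I : Type) (r : seq I) (P : pred I)
    (F : I -> tupleR R d -> R) :
  (forall i, P i -> dyadic_step k (F i)) ->
  dyadic_step k (fun x => \sum_(i <- r | P i) F i x).
Proof. by move=> stF p x px; apply: eq_bigr => i Pi; exact: stF. Qed.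

Lemma dyadic_step_prod k (I : Type) (r : seq I) (P : pred I)
    (F : I -> tupleR R d -> R) :
  (forall i, P i -> dyadic_step k (F i)) ->
  dyadic_step k (fun x => \prod_(i <- r | P i) F i x).
Proof. by move=> stF p x px; apply: eq_bigr => i Pi; exact: stF. Qed.

Lemma dyadic_step_walsh k n i : (n < 2 ^ k)%N ->
  dyadic_step k (fun x => walsh n (tnth x i)).
Proof.
move=> nk p x px.
have := px i; have := dyadic_node_cell p i; rewrite /= !in_itv /=.
by move=> h1 h2; rewrite (walsh_cell nk h1) (walsh_cell nk h2).
Qed.

Lemma dyadic_step_walshd k (j : 'I_d -> nat) : (forall i, (j i < 2 ^ k)%N) ->
  dyadic_step k (walshd j).
Proof. by move=> jk; apply: dyadic_step_prod => i _; exact: dyadic_step_walsh. Qed.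

(** A finite Fubini theorem: the corners form a product grid. *)
Lemma sum_dyadic_node k (h : 'I_d -> R -> R) :
  (2 ^- k) ^+ d * \sum_(p : {ffun 'I_d -> 'I_(2 ^ k)})
    \prod_i h i (tnth (dyadic_node p) i) =
  \prod_i (2 ^- k * \sum_(q < 2 ^ k) h i (q%:R / 2 ^+ k)).
Proof.
rewrite big_split /= prodr_const card_ord; congr (_ * _).
rewrite bigA_distr_bigA /=; apply: eq_bigr => p _; apply: eq_bigr => i _.
by rewrite tnth_mktuple.
Qed.

End dyadic_step.

(** * Tensor products of Dirichlet kernels *)

(** Distributivity when the range of summation depends on the coordinate, as it does in
    [rect_sum]. *)
Lemma sum_dffun_prod (S : comPzSemiRingType) (I : finType) (T_ : I -> finType)
    (F : forall i, T_ i -> S) :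
  \sum_(j : {dffun forall i, T_ i}) \prod_i F i (j i) =
  \prod_i \sum_(m : T_ i) F i m.
Proof.
pose P_ i : {ffun T_ i -> S} := finfun (F i).
rewrite (reindex (@dffun_of_fprod _ T_)); last first.
  exact/onW_bij/dffun_of_fprod_bij.
transitivity (\sum_(t : fprod T_) \prod_(i in I) P_ i (t i)).
  by apply: eq_bigr => t _; apply: eq_bigr => i _; rewrite !ffunE.
rewrite big_fprod; transitivity (\prod_i \sum_(u in tagged_with T_ i) untag 0 (P_ i) u).
  by rewrite (bigA_distr_big_dep _ (fun i u => untag 0 (P_ i) u)).
apply: eq_bigr => i _; transitivity (\sum_(m : T_ i) P_ i m).
  by rewrite (big_tag (fun i => P_ i : T_ i -> S)).
by apply: eq_bigr => m _; rewrite ffunE.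
Qed.

Section dirichlet_tensor.
Variables (R : realType) (d : nat) (B : {set 'I_d}).
Implicit Types (x : tupleR R d) (A : nat) (j : 'I_d -> nat).

Definition dirichlet_tensor A x : R :=
  \prod_(i in B) \sum_(l < 2 ^ A.*2) walsh l (tnth x i).

Definition dirichlet_height A : R := (2 ^+ A.*2) ^+ #|B|.

Definition dirichlet_coef A j : R :=
  \prod_i (if i \in B then (j i < 2 ^ A.*2)%N else j i == 0%N)%:R.

Lemma dirichlet_height_gt0 A : 0 < dirichlet_height A.
Proof. by rewrite exprn_gt0// exprn_gt0. Qed.

Lemma dirichlet_coef_ge0 A j : 0 <= dirichlet_coef A j.
Proof. by apply: prodr_ge0 => i _; rewrite ler0n. Qed.

(** Each Dirichlet kernel is a product of factors $1 + r_s$, which are 0 or 2. *)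
Lemma dirichlet_tensorE A x :
  dirichlet_tensor A x = 0 \/ dirichlet_tensor A x = dirichlet_height A.
Proof.
have h1 (y : R) : \sum_(l < 2 ^ A.*2) walsh l y = 0 \/
    \sum_(l < 2 ^ A.*2) walsh l y = 2 ^+ A.*2.
  rewrite walsh_dirichlet.
  have [/existsP[s /eqP s1]|] := boolP [exists s : 'I_A.*2, rademacher s y == -1].
    by left; rewrite (bigD1 s)//= s1 subrr mul0r.
  rewrite negb_exists => /forallP s1; right.
  rewrite (eq_bigr (fun=> 2)) ?prodr_const ?card_ord// => s _.
  by have /eqP := s1 s; case: (rademacherE s y) => ->.
rewrite /dirichlet_tensor /dirichlet_height.
have [/existsP[i /andP[iB /eqP i0]]|] := boolP [exists i : 'I_d, (i \in B) &&
    (\sum_(l < 2 ^ A.*2) walsh l (tnth x i) == 0)].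
  by left; rewrite (bigD1 i)//= i0 mul0r.
rewrite negb_exists => /forallP i0; right.
rewrite (eq_bigr (fun=> 2 ^+ A.*2)) ?prodr_const// => i iB.
by have := i0 i; rewrite iB /= => /eqP; case: (h1 (tnth x i)) => ->.
Qed.

Lemma dirichlet_tensor_ge0 A x : 0 <= dirichlet_tensor A x.
Proof.
by have [->//|->] := dirichlet_tensorE A x; exact/ltW/dirichlet_height_gt0.
Qed.

Lemma dyadic_step_dirichlet_tensor A k : (A.*2 <= k)%N ->
  dyadic_step k (dirichlet_tensor A).
Proof.
move=> Ak; apply: dyadic_step_prod => i _; apply: dyadic_step_sum => l _.
by apply: dyadic_step_walsh; rewrite (leq_trans (ltn_ord l))// leq_exp2l.
Qed.

Lemma walsh_coef_dirichlet_tensor A (c : R) j :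
  walsh_coef (fun x => c * dirichlet_tensor A x) j = c * dirichlet_coef A j.
Proof.
(* A resolution at which both the tensor and [walshd j] are constant on cells. *)
pose k := (A.*2 + \max_i j i)%N.
have jk i : (j i < 2 ^ k)%N.
  rewrite (leq_trans (ltn_expl (j i) (ltnSn 1)))// leq_exp2l//.
  by rewrite (leq_trans (leq_bigmax i))// leq_addl.
rewrite /walsh_coef /Rintegral (integral_dyadic_step (k := k)) /=; last first.
  apply: dyadic_stepM; last exact: dyadic_step_walshd.
  apply: dyadic_stepM => //; apply: dyadic_step_dirichlet_tensor.
  exact: leq_addr.
under eq_bigr => p _ do rewrite -mulrA /dirichlet_tensor big_mkcond -big_split /=.
rewrite -mulr_sumr mulrCA; congr (_ * _).
rewrite (sum_dyadic_node k (fun i y => (if i \in B then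
  \sum_(l < 2 ^ A.*2) walsh l y else 1) * walsh (j i) y)).
have k0 : (2 : R) ^+ k != 0 by rewrite expf_neq0.
apply: eq_bigr => i _; case: ifP => iB.
  under eq_bigr do rewrite mulr_suml.
  rewrite exchange_big /=.
  rewrite (eq_bigr (fun l : 'I__ => if (l : nat) == j i then 2 ^+ k else 0)); last first.
    move=> l _; rewrite walsh_orthogonal// (leq_trans (ltn_ord l))//.
    by rewrite leq_exp2l// leq_addr.
  rewrite -big_mkcond /=; case: ltnP => jA.
    by rewrite (big_pred1 (Ordinal jA))// mulVf.
  rewrite big_pred0 ?mulr0// => l; apply/negbTE; rewrite neq_ltn.
  by rewrite (leq_trans (ltn_ord l)).
(* Outside [B] the constant 1 is read as the Walsh function of index 0, so that orthogonality
   applies there too. *)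
rewrite (eq_bigr (fun q : 'I__ => walsh 0 (q%:R / 2 ^+ k) *
  walsh (j i) (q%:R / 2 ^+ k))); last by move=> q _; rewrite walsh0.
rewrite walsh_orthogonal ?expn_gt0//.
by rewrite eq_sym; case: eqP => _; rewrite ?mulr0// mulVf.
Qed.

Lemma integral_dirichlet_tensor A (c : R) :
  (\int[lebesgue_tuple R d]_(x in cube R d) (c * dirichlet_tensor A x)%:E)%E =
  c%:E.
Proof.
have stD : dyadic_step A.*2 (fun x => c * dirichlet_tensor A x).
  exact/dyadic_stepM/dyadic_step_dirichlet_tensor.
have := walsh_coef_dirichlet_tensor A c (fun=> 0%N).
rewrite /walsh_coef /Rintegral.
under eq_integral => x _.
  rewrite [walshd _ x]big1 ?mulr1; last by move=> i _; rewrite walsh0.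
  over.
rewrite (integral_dyadic_step stD) /= => ->; congr EFin.
rewrite /dirichlet_coef big1 ?mulr1// => i _.
by rewrite expn_gt0 if_same.
Qed.

(** As $D_A$ takes only the values 0 and [t = dirichlet_height A], and $Q(0) = 0$, the integrand
    equals $(Q(ct)/t) D_A$ pointwise, and $D_A$ has integral 1. *)
Lemma integral_comp_dirichlet_tensor A (Q : R -> R) (c : R) : Q 0 = 0 -> 0 <= c ->
  (\int[lebesgue_tuple R d]_(x in cube R d) (Q `|c * dirichlet_tensor A x|)%:E)%E =
  (Q (c * dirichlet_height A) / dirichlet_height A)%:E.
Proof.
move=> Q0 c0; rewrite -(integral_dirichlet_tensor A); apply: eq_integral => x _.
congr EFin; rewrite ger0_norm ?mulr_ge0 ?dirichlet_tensor_ge0//.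
have [->|->] := dirichlet_tensorE A x; first by rewrite !mulr0.
by rewrite divfK// gt_eqF// dirichlet_height_gt0.
Qed.

Lemma dyadic_step_mixed_log_mean k n (f : tupleR R d -> R) : (n <= 2 ^ k)%N ->
  dyadic_step k (mixed_log_mean_diag B n f).
Proof.
move=> nk; apply: dyadic_stepM => //.
apply: dyadic_step_sum => i _; apply: dyadic_stepM => //.
apply: dyadic_step_sum => j _; apply: dyadic_stepM => //.
apply: dyadic_step_walshd => s; apply: leq_trans nk; apply: leq_trans (ltn_ord _) _.
by case: ifP => _; [exact: leq_subr|exact: ltnW].
Qed.

(** Duality: integrate the mean against [Phi], which is bounded by 1. The Walsh coefficients of
    [Phi] below [n] are nonnegative, so those of [f] may be replaced by their lower bounds. The
    resulting sum factors over the coordinates into Noerlund means, at least $A/128$, for [B], and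
    factors 1 elsewhere. *)
Lemma L1_mixed_log_mean_ge A (f : tupleR R d -> R) (c : R) : (2 <= A)%N -> 0 <= c ->
  (forall j, c * dirichlet_coef A j <= walsh_coef f j) ->
  ((c * (A%:R / 128) ^+ #|B|)%:E <=
   L1_norm (mixed_log_mean_diag B (osc_index A) f))%E.
Proof.
move=> A2 c0 fc; set n := osc_index A; set k := A.*2.
have nk : (n <= 2 ^ k)%N by exact/ltnW/osc_index_lt.
have n2 : (2 <= n)%N by exact: osc_index_ge2.
have n0 : (0 < n)%N by exact: ltnW.
have stT := dyadic_step_mixed_log_mean f nk.
set T := mixed_log_mean_diag B n f in stT *.
(* The integral of step functions of order [k], written as a finite sum so that its linearity is
   plain algebra. *)
pose E (G : tupleR R d -> R) := (2 ^- k) ^+ d *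
  \sum_(p : {ffun 'I_d -> 'I_(2 ^ k)}) G (dyadic_node R p).
pose Phi x := \prod_i (if i \in B then test_fun A (tnth x i : R) else 1).
(* The one-dimensional Walsh coefficients of the factors of [Phi]. *)
pose psi (i : 'I_d) (m : nat) : R := if i \in B then test_coef R A m else (m == 0%N)%:R.
have EZ a G : E (fun x => a * G x) = a * E G.
  by rewrite /E -mulr_sumr mulrCA.
have Esum (I : finType) (P : pred I) (G : I -> tupleR R d -> R) :
    E (fun x => \sum_(i | P i) G i x) = \sum_(i | P i) E (G i).
  by rewrite /E exchange_big /= mulr_sumr.
have Ewalsh (j : 'I_d -> nat) : (forall i, (j i < n)%N) ->
    E (fun x => walshd j x * Phi x) = \prod_i psi i (j i).
  move=> jn; have jk i : (j i < 2 ^ k)%N by exact: leq_trans (jn i) nk.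
  have k0 : (2 : R) ^+ k != 0 by rewrite expf_neq0.
  rewrite /E /walshd /Phi /=; under eq_bigr do rewrite -big_split /=.
  rewrite (sum_dyadic_node k (fun i y => walsh (j i) y *
    (if i \in B then test_fun A y else 1))).
  apply: eq_bigr => i _; rewrite /psi; case: ifP => iB.
    rewrite /test_fun; under eq_bigr do rewrite mulr_sumr.
    rewrite exchange_big /= (bigD1 (Ordinal (jk i)))//= [X in _ + X]big1 ?addr0; last first.
      move=> l lj; under eq_bigr do rewrite mulrCA.
      rewrite -mulr_sumr walsh_orthogonal// ifF ?mulr0//.
      by apply: contraNF lj => /eqP ji; apply/eqP/val_inj.
    under eq_bigr do rewrite mulrCA.
    by rewrite -mulr_sumr walsh_orthogonal// eqxx mulrCA mulVf// mulr1.
  rewrite (eq_bigr (fun q : 'I__ => walsh (j i) (q%:R / 2 ^+ k) *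
    walsh 0 (q%:R / 2 ^+ k))); last by move=> q _; rewrite walsh0.
  rewrite walsh_orthogonal ?expn_gt0//.
  by case: eqP => _; rewrite ?mulr0// mulVf.
have psi0 i m : (m < n)%N -> 0 <= psi i m.
  by move=> mn; rewrite /psi; case: ifP => // _; exact: test_coef_ge0.
(* For indices below [n], [dirichlet_coef] is 1 wherever the product of the [psi] is nonzero. *)
have coefpsi (j : 'I_d -> nat) : (forall i, (j i < n)%N) ->
    dirichlet_coef A j * \prod_i psi i (j i) = \prod_i psi i (j i).
  move=> jn; rewrite /dirichlet_coef -big_split; apply: eq_bigr => i _ /=.
  rewrite /psi; case: ifP => _; first by rewrite (leq_trans (jn i) nk) mul1r.
  by case: eqP => _; rewrite ?mul1r// mul0r.
have -> : L1_norm T = (E (fun x => `|T x|))%:E.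
  by rewrite /L1_norm (integral_dyadic_step (k := k))//; exact: dyadic_step_comp.
rewrite lee_fin; apply: (@le_trans _ _ (E (fun x => T x * Phi x))); last first.
  rewrite /E ler_wpM2l ?exprn_ge0 ?invr_ge0//.
  apply: ler_sum => p _; apply: le_trans (ler_norm _) _; rewrite normrM ler_piMr//.
  rewrite /Phi normr_prod; apply: prodr_ile1 => i _.
  by rewrite normr_ge0 /=; case: ifP => _; rewrite ?normr1// norm_test_fun.
pose N (s : 'I_d) (i : nat) := (if s \in B then n - i else i)%N.
have Nn s (i : 'I_n) : (N s i <= n)%N.
  by rewrite /N; case: ifP => _; [exact: leq_subr|exact: ltnW].
have ETE : E (fun x => T x * Phi x) = (\prod_(j < d) harmonic_sum R n)^-1 *
    \sum_(i : {dffun forall j : 'I_d, 'I_n} | [forall j, (0 < i j)%N])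
      (\sum_(j : {dffun forall s : 'I_d, 'I_(N s (i s))})
        walsh_coef f (fun s => j s) * \prod_s psi s (j s)) / \prod_(j < d) (i j)%:R.
  rewrite /T /mixed_log_mean_diag /mixed_log_mean.
  transitivity (E (fun x => (\prod_(j < d) harmonic_sum R n)^-1 *
    \sum_(i : {dffun forall j : 'I_d, 'I_n} | [forall j, (0 < i j)%N])
      ((\prod_(j < d) (i j)%:R)^-1 *
      \sum_(j : {dffun forall s : 'I_d, 'I_(N s (i s))})
        walsh_coef f (fun s => j s) * (walshd (fun s => j s) x * Phi x)))).
    congr E; apply/funext => x; rewrite -mulrA; congr (_ * _).
    rewrite mulr_suml; apply: eq_bigr => i _; rewrite mulrAC mulrC; congr (_ * _).
    by rewrite /rect_sum mulr_suml; apply: eq_bigr => j _; rewrite mulrA.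
  rewrite EZ Esum; congr (_ * _); apply: eq_bigr => i _; rewrite EZ mulrC Esum.
  congr (_ * _); apply: eq_bigr => j _; rewrite EZ Ewalsh// => s.
  exact: leq_trans (ltn_ord _) (Nn _ _).
have l0 : 0 < harmonic_sum R n by exact: harmonic_sum_gt0.
rewrite ETE; apply: (@le_trans _ _ ((\prod_(j < d) harmonic_sum R n)^-1 *
    \sum_(i : {dffun forall j : 'I_d, 'I_n} | [forall j, (0 < i j)%N])
      (\sum_(j : {dffun forall s : 'I_d, 'I_(N s (i s))})
        c * \prod_s psi s (j s)) / \prod_(j < d) (i j)%:R)); last first.
  rewrite ler_wpM2l ?invr_ge0 ?prodr_ge0// => [j _|]; first exact: ltW.
  apply: ler_sum => i _; rewrite ler_wpM2r ?invr_ge0 ?prodr_ge0//.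
  apply: ler_sum => j _; have jn s : (j s < n)%N by exact: leq_trans (ltn_ord _) (Nn _ _).
  rewrite -[leLHS](congr1 ( *%R c) (coefpsi (fun s => j s) jn)) mulrA ler_wpM2r// prodr_ge0// => s _.
  exact: psi0.
have -> : (\prod_(j < d) harmonic_sum R n)^-1 *
    \sum_(i : {dffun forall j : 'I_d, 'I_n} | [forall j, (0 < i j)%N])
      (\sum_(j : {dffun forall s : 'I_d, 'I_(N s (i s))})
        c * \prod_s psi s (j s)) / \prod_(j < d) (i j)%:R =
    c * \prod_(s < d) ((harmonic_sum R n)^-1 *
       \sum_(i < n) (\sum_(m < N s i) psi s m) / i%:R).
  rewrite big_split /= prodfV mulrCA; congr (_ * _).
  rewrite -(sum_dffun_prod (T_ := fun=> 'I_n : finType)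
    (fun s (i : 'I_n) => (\sum_(m < N s i) psi s m) / i%:R)) mulr_sumr.
  rewrite big_mkcond; apply: eq_bigr => i _; rewrite -mulr_sumr -mulrA.
  rewrite (sum_dffun_prod (T_ := fun s => 'I_(N s (i s)) : finType)
     (fun s (m : 'I_(N s (i s))) => psi s m)) -prodf_div.
  (* The factored sum also runs over tuples with a zero coordinate; these contribute nothing,
     because the inverse of 0 is 0. *)
  case: ifPn => //; rewrite negb_forall => /existsP[s].
  rewrite lt0n negbK => /eqP is0.
  by rewrite (bigD1 s)//= is0 invr0 mulr0 mul0r mulr0.
rewrite ler_wpM2l// -[leLHS]mulr1.
have -> : (A%:R / 128 : R) ^+ #|B| * 1 =
    \prod_(s < d) (if s \in B then A%:R / 128 else 1).
  by rewrite -big_mkcond prodr_const mulr1.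
have A1 : (2 : R) <= A%:R by rewrite ler_nat.
have sum1 (F : nat -> R) : \sum_(i < n) F i / i%:R = \sum_(1 <= i < n) F i / i%:R.
  rewrite -(big_mkord xpredT (fun i => F i / i%:R)) big_ltn//.
  by rewrite invr0 mulr0 add0r.
apply: ler_prod => s _; rewrite (sum1 (fun i => \sum_(m < N s i) psi s m)).
rewrite /N /psi; case: ifP => sB.
  apply/andP; split; first by lra.
  apply: le_trans (norlund_mean_ge R A2) _; rewrite ler_pM2l ?invr_gt0//.
  by rewrite /norlund_sum; apply: ler_sum => i _; rewrite mulrC.
(* Outside [B] every inner sum with [i >= 1] contains the single nonzero term [m = 0], so the Riesz
   mean is the harmonic sum divided by itself. *)
rewrite ler01 /= (eq_big_nat _ _ (F2 := fun i => i%:R^-1)).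
  by rewrite mulVf// gt_eqF.
move=> [//|i] _; rewrite big_ord_recl eqxx big1 ?addr0 ?mul1r//.
Qed.

End dirichlet_tensor.

(** * Young functions *)

Section young_function_theory.
Variables (R : realType) (Q : R -> R).
Hypothesis hQ : young_function Q.

Lemma young0 : Q 0 = 0.
Proof. by case: hQ => _ _ [_ ->]. Qed.

Lemma young_conv (t x y : R) : 0 <= t -> t <= 1 ->
  Q (t * x + (1 - t) * y) <= t * Q x + (1 - t) * Q y.
Proof.
move=> t0 t1; case: hQ => cQ _ _ _ _.
by have := cQ (Itv01 t0 t1) x y; rewrite !inE => /(_ I I); rewrite !convRE.
Qed.

(** Convexity at the midpoint of [x] and [-x], together with evenness. *)
Lemma young_ge0 x : 0 <= Q x.
Proof.
have := @young_conv 2^-1 x (- x) ltac:(lra) ltac:(lra).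
case: hQ => _ _ [ev _] _ _; rewrite ev.
rewrite (_ : _ + _ * - x = 0) ?young0; last by lra.
by lra.
Qed.

Lemma young_scale (t x : R) : 0 <= t -> t <= 1 -> Q (t * x) <= t * Q x.
Proof. by move=> t0 t1; have := young_conv x 0 t0 t1; rewrite young0 !mulr0 !addr0. Qed.

Lemma young_le (x y : R) : 0 <= x -> x <= y -> Q x <= Q y.
Proof.
move=> x0 xy; have [y0|y0] := eqVneq y 0.
  by have -> : x = y by apply/eqP; rewrite eq_le xy y0.
have yp : 0 < y by rewrite lt_neqAle eq_sym y0 (le_trans x0).
rewrite -(divfK y0 x); apply: le_trans (young_scale _ _ _) _.
- by rewrite divr_ge0// ltW.
- by rewrite ler_pdivrMr// mul1r.
- by rewrite ler_piMl ?young_ge0// ler_pdivrMr// mul1r.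
Qed.

Lemma measurable_young d (T : measurableType d) (D : set T) (f : T -> R) :
  measurable_fun D f -> measurable_fun D (Q \o f).
Proof.
move=> mf; apply: measurableT_comp => //.
by apply: continuous_measurable_fun; case: hQ.
Qed.

End young_function_theory.

(** * Comparison of $u \log^b(1+u)$ with a Young function *)

Section llog.
Variable R : realType.
Implicit Types (b : nat) (u v : R).

Lemma llog_funE b u : 0 <= u -> llog_fun b%:R u = u * ln (1 + u) ^+ b.
Proof.
by move=> u0; rewrite /llog_fun ger0_norm// powR_mulrn// ln_ge0// lerDl.
Qed.

Lemma llog_fun_ge0 (beta : R) u : 0 <= llog_fun beta u.
Proof. by rewrite /llog_fun mulr_ge0// powR_ge0. Qed.

Lemma llog_fun_le b u v : 0 <= u -> u <= v -> llog_fun b%:R u <= llog_fun b%:R v.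
Proof.
move=> u0 uv; rewrite !llog_funE ?(le_trans u0)//.
have l0 : 0 <= ln (1 + u) by rewrite ln_ge0// lerDl.
rewrite ler_pM ?exprn_ge0// lerXn2r ?nnegrE//.
  by rewrite ln_ge0// lerDl (le_trans u0).
by rewrite ler_ln ?posrE ?lerD2l// ltr_pwDl// (le_trans u0).
Qed.

Lemma llog_fun_div b (c u : R) : 1 <= c -> 0 <= u ->
  llog_fun b%:R (u / c) <= llog_fun b%:R u / c.
Proof.
move=> c1 u0; have c0 : 0 < c by rewrite (lt_le_trans ltr01).
have uc : u / c <= u by rewrite ler_pdivrMr// ler_peMr.
have uc0 : 0 <= u / c by rewrite divr_ge0// ltW.
rewrite !llog_funE// [leRHS]mulrAC ler_wpM2l// lerXn2r ?nnegrE ?ln_ge0 ?lerDl//.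
by rewrite ler_ln ?posrE ?lerD2l// ltr_pwDl.
Qed.

Lemma measurable_llog_fun (beta : R) d (T : measurableType d) (D : set T)
    (f : T -> R) : measurable_fun D f -> measurable_fun D (llog_fun beta \o f).
Proof.
move=> mf; have mn : measurable_fun D (fun x => `|f x|).
  exact: measurableT_comp.
apply: measurable_funM => //.
apply: (measurableT_comp (measurable_powR beta)).
apply: (measurableT_comp (@measurable_ln R)).
exact: measurable_funD.
Qed.

Variables (Q : R -> R) (hQ : young_function Q).

(** Put $t_A = 4^{Ab}$ and $s_A = M t_A / A^b$. For $s_A \le u < s_{A+1}$ with $A \ge K$,
    monotonicity gives $Q(u) \ge Q(s_A) > t_A$. On the other side $\log(1+u)$ is at most a constant
    times $A+1$, and $s_{A+1} (A+1)^b = M 4^b t_A$, so $u \log^b(1+u)$ is at most a constant times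
    $t_A$. *)
Lemma llog_le_young b (M : R) (K : nat) : (0 < b)%N -> 0 < M ->
  (forall A, (K <= A)%N ->
    (2 ^+ A.*2) ^+ b < Q ((2 ^+ A.*2) ^+ b * M / A%:R ^+ b)) ->
  exists2 C : R, 1 <= C & forall u, 0 <= u -> llog_fun b%:R u <= C * (1 + Q u).
Proof.
move=> b0 M0 hK.
pose t A : R := (2 ^+ A.*2) ^+ b.
pose s A : R := t A * M / A%:R ^+ b.
have t0 A : 0 < t A by rewrite exprn_gt0// exprn_gt0.
have sge A : (0 < A)%N -> M * A%:R <= s A.
  move=> A0; have A0R : 0 < A%:R :> R by rewrite ltr0n.
  rewrite /s mulrAC [leRHS]mulrC ler_pM2l// /t -expr_div_n.
  have A4 : A%:R <= (2 ^+ A.*2 / A%:R : R).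
    rewrite ler_pdivlMr// -natrM -natrX ler_nat -addnn expnD.
    by apply: leq_mul; exact/ltnW/ltn_expl.
  apply: (le_trans A4); apply: ler_eXnr => //.
  by apply: le_trans A4; rewrite ler1n.
(* [C1] bounds $\log(1+u)/(A+1)$, [C2] is the resulting constant for $u \ge s_{K+1}$, and [C3]
   covers the smaller [u]. *)
pose C1 : R := ln (1 + M) + b%:R * ln 4.
have lnM_ge0 : 0 <= ln (1 + M) by rewrite ln_ge0// lerDl ltW.
have ln4 : 0 <= ln (4 : R) by rewrite ln_ge0//; lra.
have C10 : 0 <= C1 by rewrite addr_ge0// mulr_ge0.
pose C2 : R := M * 4 ^+ b * C1 ^+ b.
have C20 : 0 <= C2 by rewrite !mulr_ge0 ?exprn_ge0// ltW.
pose C3 := llog_fun b%:R (s K.+1).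
have C30 : 0 <= C3 by exact: llog_fun_ge0.
exists (1 + C2 + C3); first by lra.
move=> u u0; have Qu := young_ge0 hQ u.
have [uK|Ku] := ltP u (s K.+1).
  apply: (le_trans (llog_fun_le b u0 (ltW uK))); rewrite -/C3.
  apply: (@le_trans _ _ (1 + C2 + C3)); first by lra.
  by rewrite ler_peMr//; lra.
have exA : exists A, (K < A)%N && (u < s A).
  exists (K + (Num.trunc (u / M)).+1)%N; rewrite -addn1 leq_add2l ltnS leq0n /=.
  apply: lt_le_trans (sge _ _); last by rewrite addnS.
  have /andP[_] := @truncn_itv R (u / M) ltac:(by rewrite divr_ge0// ltW).
  rewrite ltr_pdivrMr// mulrC => /lt_le_trans; apply.
  by rewrite ler_pM2l// ler_nat leq_addl.
(* Minimality places [u] between [s A] and [s A.+1]; the possibility [A = K] is excluded by [Ku]. *)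
case: (ex_minnP exA) => -[//|A] /andP[KA uA] minA.
have sA : s A <= u.
  have [->//|AK] := eqVneq A K.+1.
  rewrite leNgt; apply/negP => uA'.
  have /minA : (K < A)%N && (u < s A).
    rewrite uA' andbT; move: KA; rewrite ltnS leq_eqVlt => /orP[/eqP KA|//].
    by move: Ku uA; rewrite KA => /le_lt_trans h /h; rewrite ltxx.
  by rewrite ltnn.
have {KA} KA : (K <= A)%N by [].
have sA0 : 0 <= s A by rewrite /s divr_ge0 ?exprn_ge0// mulr_ge0// ltW.
have QA : t A <= Q u.
  by apply: le_trans (ltW (hK A KA)) _; exact: young_le.
have A1 : (0 : R) < A.+1%:R by rewrite ltr0n.
have lnu : ln (1 + u) <= C1 * A.+1%:R.
  have A1b : 1 <= A.+1%:R ^+ b :> R by rewrite exprn_ege1// ler1n.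
  have t1 : 1 <= t A.+1 by rewrite exprn_ege1// exprn_ege1//; lra.
  have : 1 + u <= (1 + M) * t A.+1.
    rewrite mulrDl mul1r lerD//; apply: le_trans (ltW uA) _.
    rewrite /s ler_pdivrMr ?(lt_le_trans ltr01 A1b)// mulrC.
    by rewrite ler_peMr// mulr_ge0 ?ltW.
  have M1 : 0 < 1 + M by rewrite addr_gt0.
  have u1 : 0 < 1 + u by rewrite ltr_pwDl.
  move=> ut; apply: (@le_trans _ _ (ln ((1 + M) * t A.+1))).
    by rewrite ler_ln ?posrE ?mulr_gt0.
  rewrite lnM ?posrE//.
  have -> : t A.+1 = 4 ^+ (b * A.+1).
    by rewrite /t -mul2n exprM -exprM mulnC (_ : 2 ^+ 2 = 4 :> R)//; lra.
  rewrite lnXn// -(mulr_natl (ln 4)) natrM /C1 mulrDl lerD//.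
    by rewrite ler_peMr// ler1n.
  by rewrite mulrAC.
rewrite llog_funE//.
apply: (@le_trans _ _ (s A.+1 * (C1 * A.+1%:R) ^+ b)).
  have l0 : 0 <= ln (1 + u) by rewrite ln_ge0// lerDl.
  rewrite ler_pM ?exprn_ge0 ?(ltW uA)// lerXn2r ?nnegrE//.
  by rewrite mulr_ge0.
have -> : s A.+1 * (C1 * A.+1%:R) ^+ b = C2 * t A.
  have e4 : 2 ^+ A.+1.*2 = 4 * 2 ^+ A.*2 :> R by rewrite doubleS !exprS; ring.
  rewrite /s /C2 /t e4 (exprMn b 4) (exprMn b C1).
  by field; rewrite expf_neq0// gt_eqF.
apply: (@le_trans _ _ (C2 * Q u)); first by rewrite ler_wpM2l.
by nra.
Qed.

End llog.

(** * Unboundedness of the operator norms *)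

Section orlicz_embedding.
Variables (R : realType) (d : nat) (Q : R -> R).
Hypothesis hQ : young_function Q.

Lemma orlicz_space_le1 (f : tupleR R d -> R) : measurable_fun (cube R d) f ->
  (\int[lebesgue_tuple R d]_(x in cube R d) (Q `|f x|)%:E <= 1)%E ->
  orlicz_space d Q f /\ (orlicz_norm Q f <= 1)%E.
Proof.
move=> mf Qf; have f1 : (orlicz_norm Q f <= 1)%E.
  apply: ereal_inf_lbound; exists 1 => //; split => //.
  by under eq_integral do rewrite divr1.
by split => //; split => //; exact: le_lt_trans f1 (ltry _).
Qed.

(** If [k] is admissible for [Q], then [2 * C * k] is admissible for [llog_fun]: dividing by [2 * C]
    bounds the integrand by $(1 + Q(|f|/k))/2$, whose integral over the cube of measure 1 is at most
    1. *)
Lemma orlicz_space_sub_llog (b : nat) (C : R) : 1 <= C ->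
  (forall u, 0 <= u -> llog_fun b%:R u <= C * (1 + Q u)) ->
  orlicz_space d Q `<=` llog_space d b%:R.
Proof.
move=> C1 hC f [mf]; have mC := @measurable_cube R d.
move=> /ereal_inf_lt[_ [k [k0 Qk] <-] _]; split => //.
have C0 : 0 < 2 * C by lra.
apply: (@le_lt_trans _ _ (2 * C * k)%:E); last exact: ltry.
apply: ereal_inf_lbound; exists (2 * C * k) => //; split; first by rewrite mulr_gt0.
have mk (r : R) : measurable_fun (cube R d) (fun x => `|f x| / r).
  by apply: measurable_funM => //; exact: measurableT_comp.
have mQ : measurable_fun (cube R d) (fun x => Q (`|f x| / k)).
  exact: (measurable_young hQ (mk k)).
apply: (@le_trans _ _ (\int[lebesgue_tuple R d]_(x in cube R d)
    (2^-1%:E * (1 + (Q (`|f x| / k))%:E)))%E).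
  apply: ge0_le_integral => //.
  - by move=> x _; rewrite lee_fin llog_fun_ge0.
  - by apply/measurable_EFinP; exact: (measurable_llog_fun _ (mk _)).
  - apply: (@measurableT_comp _ _ _ _ _ _ (fun y => 2^-1%:E * y)%E) => //.
      exact: measurable_funeM.
    by apply: emeasurable_funD => //; exact/measurable_EFinP.
  - move=> x _; rewrite -EFinD -EFinM lee_fin.
    have u0 : 0 <= `|f x| / k by rewrite divr_ge0// ltW.
    rewrite (_ : `|f x| / _ = `|f x| / k / (2 * C)); last first.
      by rewrite -[RHS]mulrA -invfM [k * _]mulrC.
    apply: le_trans (llog_fun_div b _ u0) _; first by lra.
    rewrite ler_pdivrMr//; apply: le_trans (hC _ u0) _.
    by have := young_ge0 hQ (`|f x| / k); nra.
rewrite ge0_integralZl//; last 2 first.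
- by apply: emeasurable_funD => //; exact/measurable_EFinP.
- by move=> x _; rewrite adde_ge0// lee_fin young_ge0.
rewrite ge0_integralD//; last 2 first.
- by move=> x _; rewrite lee_fin young_ge0.
- exact/measurable_EFinP.
rewrite integral_cst// mul1e.
rewrite [X in (_ * (X + _))%E](cube_measure R d).
apply: (@le_trans _ _ (2^-1%:E * (1 + 1))%E).
  by rewrite lee_pmul2l// leeD2l.
by rewrite -EFinD -EFinM lee_fin; lra.
Qed.

Variable B : {set 'I_d}.

(** The integral equals $Q(M t/A^b)/t$ with $b = |B|$ and $t = 4^{Ab}$. If it exceeded 1 for all $A
    \ge K$, [llog_le_young] would give the excluded inclusion. *)
Lemma exists_cheap_dirichlet_tensor (M : R) (K : nat) : B != finset.set0 ->
  ~ (orlicz_space d Q `<=` llog_space d #|B|%:R) -> 0 < M ->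
  exists2 A, (K <= A)%N &
    (\int[lebesgue_tuple R d]_(x in cube R d)
       (Q `|M / A%:R ^+ #|B| * dirichlet_tensor B A x|)%:E <= 1)%E.
Proof.
move=> B0 hLQ M0; apply: contra_notP hLQ => noA.
have b0 : (0 < #|B|)%N by rewrite card_gt0.
have [|C C1 hC] := @llog_le_young R Q hQ #|B| M K b0 M0; last first.
  exact: orlicz_space_sub_llog C1 hC.
move=> A KA; rewrite ltNge; apply/negP => QA; apply: noA; exists A => //.
rewrite integral_comp_dirichlet_tensor ?(young0 hQ)//; last first.
  by rewrite divr_ge0 ?exprn_ge0// ltW.
rewrite lee_fin ler_pdivrMr ?dirichlet_height_gt0// mul1r.
by rewrite (_ : _ * dirichlet_height R B A =
  (2 ^+ A.*2) ^+ #|B| * M / A%:R ^+ #|B|)// mulrC mulrA.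
Qed.

Lemma op_norm_mixed_log_mean_unbounded : B != finset.set0 ->
  ~ (orlicz_space d Q `<=` llog_space d #|B|%:R) ->
  (ereal_sup [set op_norm Q (@mixed_log_mean_diag R d B n) |
              n in [set n : nat | (2 <= n)%N]] = +oo)%E.
Proof.
move=> B0 hLQ; apply/eqyP => V V0.
(* With this [M] the lower bound $M A^{-b} (A/128)^b$ is exactly [V]. *)
have M0 : 0 < V * 128 ^+ #|B| by rewrite mulr_gt0 ?exprn_gt0.
have [A A2 QA] := exists_cheap_dirichlet_tensor 2 B0 hLQ M0.
set c := V * _ / _ in QA; set f := fun x => c * dirichlet_tensor B A x.
have A0 : (A%:R : R) != 0 by rewrite pnatr_eq0 -lt0n (leq_trans _ A2).
have c0 : 0 <= c by rewrite divr_ge0 ?exprn_ge0// ltW.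
have stf : dyadic_step A.*2 f.
  exact/dyadic_stepM/dyadic_step_dirichlet_tensor.
have := orlicz_space_le1 (measurable_dyadic_step stf) QA.
move=> fQ; apply: (@le_trans _ _ (L1_norm (mixed_log_mean_diag B (osc_index A) f))).
  apply: le_trans (L1_mixed_log_mean_ge A2 c0 _).
    rewrite lee_fin /c expr_div_n.
    by rewrite le_eqVlt; apply/orP; left; apply/eqP; field; rewrite !expf_neq0.
  by move=> j; rewrite walsh_coef_dirichlet_tensor.
apply: (@le_trans _ _ (op_norm Q (@mixed_log_mean_diag R d B (osc_index A)))).
  by apply: ereal_sup_ubound; exists f.
by apply: ereal_sup_ubound; exists (osc_index A) => //=; exact: osc_index_ge2.
Qed.

End orlicz_embedding.

(** * A function with divergent means *)

Section walsh_divergence.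
Variables (R : realType) (d : nat) (Q : R -> R) (B : {set 'I_d}).
Hypothesis hQ : young_function Q.
Local Notation mu := (lebesgue_tuple R d).
Local Notation D := (dirichlet_tensor B).

Lemma integrable_dyadic_step k (G : tupleR R d -> R) : dyadic_step k G ->
  mu.-integrable (cube R d) (EFin \o G).
Proof.
move=> stG; apply/integrableP; split.
  by apply/measurable_EFinP; exact: measurable_dyadic_step stG.
rewrite (integral_dyadic_step (dyadic_step_comp (fun y => `|y|) stG)).
exact: ltry.
Qed.

Lemma integrable_dirichlet_tensor_walshd (c : R) A (j : 'I_d -> nat) :
  mu.-integrable (cube R d) (fun x => (c * D A x * walshd j x)%:E).
Proof.
pose k := (A.*2 + \max_i j i)%N.
apply: (@integrable_dyadic_step k (fun x => c * D A x * walshd j x)).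
apply: dyadic_stepM; last first.
  apply: dyadic_step_walshd => i.
  rewrite (leq_trans (ltn_expl (j i) (ltnSn 1)))// leq_exp2l//.
  by rewrite (leq_trans (leq_bigmax i))// leq_addl.
apply: dyadic_stepM => //; apply: dyadic_step_dirichlet_tensor.
exact: leq_addr.
Qed.

Lemma integral_dirichlet_tensor_walshd (c : R) A (j : 'I_d -> nat) :
  (\int[mu]_(x in cube R d) (c * D A x * walshd j x)%:E)%E =
  (c * dirichlet_coef R B A j)%:E.
Proof.
rewrite -walsh_coef_dirichlet_tensor /walsh_coef /Rintegral fineK//.
apply: integrable_fin_num; first exact: measurable_cube.
exact: integrable_dirichlet_tensor_walshd.
Qed.

Lemma norm_walshd (j : 'I_d -> nat) (x : tupleR R d) : `|walshd j x| = 1.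
Proof. by rewrite /walshd normr_prod big1// => i _; rewrite norm_walsh. Qed.

Lemma measurable_walshd (j : 'I_d -> nat) :
  measurable_fun (cube R d) (walshd j : tupleR R d -> R).
Proof.
apply: (@measurable_dyadic_step _ _ (\max_i j i)); apply: dyadic_step_walshd => i.
rewrite (leq_trans (ltn_expl (j i) (ltnSn 1)))// leq_exp2l//.
exact: leq_bigmax.
Qed.

Lemma sum_half_powers_le1 m : \sum_(0 <= l < m) (2 : R) ^- l.+1 <= 1.
Proof.
suff -> : \sum_(0 <= l < m) (2 : R) ^- l.+1 = 1 - 2 ^- m.
  by rewrite gerBl invr_ge0 exprn_ge0.
elim: m => [|m IH]; first by rewrite big_geq// expr0 invr1 subrr.
by rewrite big_nat_recr//= IH exprS; field; rewrite expf_neq0.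
Qed.

Lemma nneseries_half_le1 (u : nat -> \bar R) :
  (forall l, 0 <= u l <= (2 ^- l.+1)%:E)%E -> (\sum_(0 <= l <oo) u l <= 1)%E.
Proof.
move=> u01; apply: lime_le.
  by apply: is_cvg_nneseries => l _ _; case/andP: (u01 l).
apply: nearW => m; apply: (@le_trans _ _ (\sum_(0 <= l < m) (2 ^- l.+1)%:E)%E).
  by apply: lee_sum => l _; case/andP: (u01 l).
by rewrite sumEFin lee_fin sum_half_powers_le1.
Qed.

(** Jensen's inequality, the missing weight $2^{-m}$ being placed at 0, where [Q] vanishes. The
    first term has weight 1/2, and the rest is half of a sum of the same form. *)
Lemma young_sum_half (g : nat -> R) m :
  Q (\sum_(0 <= l < m) 2 ^- l.+1 * g l) <= \sum_(0 <= l < m) 2 ^- l.+1 * Q (g l).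
Proof.
elim: m g => [|m IH] g; first by rewrite !big_geq// (young0 hQ).
have half (h : nat -> R) : \sum_(0 <= l < m.+1) 2 ^- l.+1 * h l =
    2^-1 * h 0%N + (1 - 2^-1) * \sum_(0 <= l < m) 2 ^- l.+1 * h l.+1.
  rewrite big_nat_recl// expr1; congr (_ + _); rewrite mulr_sumr.
  by apply: eq_bigr => l _; rewrite (exprS _ l.+1); field; rewrite expf_neq0.
rewrite !half; apply: le_trans (young_conv hQ _ _ _ _) _; [lra|lra|].
by have := IH (fun l => g l.+1); lra.
Qed.

(* The Walsh coefficients of all the [D A] are nonnegative, so no cancellation
   between the terms of the series can occur when it is tested, and the gliding
   hump argument needs no control of the other terms. *)
Section series.
Variables (A_ : nat -> nat) (c : nat -> R).
Hypothesis c01 : forall l, 0 <= c l <= 1.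
Hypothesis Qc : forall l,
  (\int[mu]_(x in cube R d) (Q `|c l * D (A_ l) x|)%:E <= 1)%E.

Let g l x := c l * D (A_ l) x.
(** In the extended reals the series always has a sum; [fine] then makes [f] zero where it is
    infinite, which by [int_F] happens only on a null set of the cube. *)
Let F x : \bar R := (\sum_(0 <= l <oo) (2 ^- l.+1 * g l x)%:E)%E.
Let f x : R := fine (F x).

Let g_ge0 l x : 0 <= g l x.
Proof. by rewrite /g mulr_ge0 ?dirichlet_tensor_ge0//; case/andP: (c01 l). Qed.

Let u_ge0 l x : (0 <= (2 ^- l.+1 * g l x)%:E)%E.
Proof. by rewrite lee_fin mulr_ge0// invr_ge0 exprn_ge0. Qed.

Let mg l : measurable_fun (cube R d) (g l).
Proof.
apply: (@measurable_dyadic_step _ _ (A_ l).*2).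
exact/dyadic_stepM/dyadic_step_dirichlet_tensor.
Qed.

Let mu_ l : measurable_fun (cube R d) (fun x => (2 ^- l.+1 * g l x)%:E).
Proof. by apply/measurable_EFinP; exact: measurable_funM. Qed.

Let F_ge0 x : (0 <= F x)%E.
Proof. by apply: nneseries_ge0 => l _ _; exact: u_ge0. Qed.

Let mF : measurable_fun (cube R d) F.
Proof. by apply: ge0_emeasurable_sum => [l x _ _|l _]; [exact: u_ge0|exact: mu_]. Qed.

Let mf : measurable_fun (cube R d) f.
Proof. exact: measurableT_comp. Qed.

Let f_ge0 x : 0 <= f x.
Proof. by rewrite /f fine_ge0. Qed.

Let int_F : (\int[mu]_(x in cube R d) F x <= 1)%E.
Proof.
rewrite /F integral_nneseries//; last exact: measurable_cube.
apply: nneseries_half_le1 => l.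
rewrite integral_ge0//=.
under eq_integral do rewrite /g mulrA.
rewrite integral_dirichlet_tensor lee_fin ler_piMr ?invr_ge0 ?exprn_ge0//.
by case/andP: (c01 l).
Qed.

Let cvgF x : (\sum_(0 <= l < m) (2 ^- l.+1 * g l x)%:E)%E @[m --> \oo] --> F x.
Proof. by apply: is_cvg_nneseries => l _ _; exact: u_ge0. Qed.

Let cvgf x : F x \is a fin_num ->
  \sum_(0 <= l < m) 2 ^- l.+1 * g l x @[m --> \oo] --> f x.
Proof.
move=> Fx; have := @cvgF x; rewrite -(fineK Fx) => /fine_cvgP[_].
by under eq_fun do rewrite /= sumEFin.
Qed.

Let L1_f : (L1_norm f <= 1)%E.
Proof.
apply: le_trans int_F; apply: ge0_le_integral => //.
- exact: measurable_cube.
- by apply/measurable_EFinP; exact: measurableT_comp.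
- move=> x _; rewrite ger0_norm// /f.
  have [Fx|] := boolP (F x \is a fin_num); first by rewrite fineK.
  by rewrite ge0_fin_numE// ltey negbK => /eqP ->; rewrite leey.
Qed.

(** Jensen's inequality holds for the partial sums and passes to the limit by continuity of [Q];
    integrating termwise bounds the integral of [Q f] by the sum of the $2^{-(l+1)}$. *)
Let orlicz_f : orlicz_space d Q f.
Proof.
have mC := @measurable_cube R d.
have mQg l : measurable_fun (cube R d) (fun x => (2 ^- l.+1 * Q `|g l x|)%:E).
  apply/measurable_EFinP; apply: measurable_funM => //.
  by apply: (measurable_young hQ); exact: measurableT_comp.
have Qg0 l x : (0 <= (2 ^- l.+1 * Q `|g l x|)%:E)%E.
  by rewrite lee_fin mulr_ge0 ?invr_ge0 ?exprn_ge0// (young_ge0 hQ).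
have [] := @orlicz_space_le1 R d Q f mf => //.
apply: (@le_trans _ _ (\int[mu]_(x in cube R d)
    \sum_(0 <= l <oo) (2 ^- l.+1 * Q `|g l x|)%:E)%E).
  apply: ge0_le_integral => //.
  - by move=> x _; rewrite lee_fin (young_ge0 hQ).
  - by apply/measurable_EFinP/(measurable_young hQ); exact: measurableT_comp.
  - by apply: ge0_emeasurable_sum.
  move=> x _; rewrite ger0_norm//.
  have [Fx|] := boolP (F x \is a fin_num); last first.
    rewrite ge0_fin_numE// ltey negbK /f => /eqP -> /=.
    by rewrite (young0 hQ) nneseries_ge0.
  have Qcvg : (Q (\sum_(0 <= l < m) 2 ^- l.+1 * g l x))%:E @[m --> \oo] -->
      (Q (f x))%:E.
    apply/fine_cvgP; split; first exact: nearW.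
    apply: (@continuous_cvg _ _ _ _ _ _ Q); last exact: cvgf.
    by case: hQ => _ + _ _ _; exact.
  rewrite -(cvg_lim _ Qcvg)//; apply: lime_le; first by apply/cvg_ex; eexists; exact: Qcvg.
  apply: nearW => m.
  apply: le_trans (nneseries_lim_ge m _) => //.
  rewrite sumEFin lee_fin; apply: le_trans (young_sum_half _ _) _.
  by apply: ler_sum => l _; rewrite (ger0_norm (g_ge0 l x)).
rewrite integral_nneseries//; apply: nneseries_half_le1 => l.
rewrite integral_ge0//=.
under eq_integral do rewrite EFinM.
rewrite ge0_integralZl_EFin//.
- rewrite -[leRHS]mule1 lee_pmul2l// ?lte_fin ?invr_gt0 ?exprn_gt0//.
  exact: Qc.
- by move=> x _; rewrite lee_fin (young_ge0 hQ).
- by apply/measurable_EFinP/(measurable_young hQ); exact: measurableT_comp.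
Qed.

(** Dominated convergence with majorant [F] makes the coefficient of [f] the limit of those of the
    partial sums. These are sums of nonnegative numbers, and contain the term [l] once [m > l]. *)
Let coef_f l j : 2 ^- l.+1 * c l * dirichlet_coef R B (A_ l) j <= walsh_coef f j.
Proof.
have mC := @measurable_cube R d.
pose s m x := \sum_(0 <= i < m) 2 ^- i.+1 * g i x.
have intF : mu.-integrable (cube R d) F.
  apply/integrableP; split => //; under eq_integral do rewrite gee0_abs//.
  by apply: le_lt_trans int_F _; exact: ltry.
have ms m : measurable_fun (cube R d) (s m).
  by apply: measurable_sum => i; apply: measurable_funM.
have [] := @dominated_convergence _ _ _ mu _ mC
  (fun m x => (s m x * walshd j x)%:E) (fun x => (f x * walshd j x)%:E) F.
- by move=> m; apply/measurable_EFinP/measurable_funM => //; exact: measurable_walshd.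
- by apply/measurable_EFinP/measurable_funM => //; exact: measurable_walshd.
- apply: filterS (integrable_ae mC intF) => x Fx Dx.
  apply/fine_cvgP; split; first exact: nearW.
  by apply: cvgM; [exact/cvgf/Fx|exact: cvg_cst].
- exact: intF.
- apply: aeW => x m _; rewrite abse_EFin normrM norm_walshd mulr1 ger0_norm.
    by rewrite -sumEFin; apply: nneseries_lim_ge.
  by apply: sumr_ge0 => i _; rewrite -lee_fin u_ge0.
move=> intfw _ cv; rewrite /walsh_coef /Rintegral -lee_fin fineK; last first.
  exact: integrable_fin_num.
rewrite -(cvg_lim _ cv)//; apply: lime_ge; first by apply/cvg_ex; eexists; exact: cv.
exists l.+1 => // m /= lm.
rewrite (_ : (\int[_]_(x in _) _)%E =
    (\sum_(0 <= i < m) (2 ^- i.+1 * c i * dirichlet_coef R B (A_ i) j))%:E); last first.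
  transitivity (\int[mu]_(x in cube R d) \sum_(0 <= i < m)
    (2 ^- i.+1 * c i * D (A_ i) x * walshd j x)%:E)%E.
    apply: eq_integral => x _; rewrite sumEFin mulr_suml; congr EFin.
    by apply: eq_bigr => i _; rewrite /g !mulrA.
  rewrite integral_sum//; last by move=> i; exact: integrable_dirichlet_tensor_walshd.
  rewrite -sumEFin; apply: eq_bigr => i _.
  exact: integral_dirichlet_tensor_walshd.
have t0 i : 0 <= 2 ^- i.+1 * c i * dirichlet_coef R B (A_ i) j.
  rewrite !mulr_ge0 ?invr_ge0 ?exprn_ge0 ?dirichlet_coef_ge0//.
  by case/andP: (c01 i).
rewrite lee_fin big_mkord (bigD1 (Ordinal lm))//= lerDl.
by apply: sumr_ge0.
Qed.

Lemma exists_orlicz_series : exists h : tupleR R d -> R,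
  [/\ orlicz_space d Q h, (L1_norm h <= 1)%E &
      forall l j,
        2 ^- l.+1 * c l * dirichlet_coef R B (A_ l) j <= walsh_coef h j].
Proof. by exists f. Qed.

End series.

(** Convergence to [h] would bound the $L_1$ norms of the means by 2 from some order on, since [h]
    has norm at most 1. At the orders [osc_index (A_ l)] the norms are at least $2^{l+1}/128^b$. *)
Lemma exists_divergent_mixed_log_mean : B != finset.set0 ->
  ~ (orlicz_space d Q `<=` llog_space d #|B|%:R) ->
  exists h : tupleR R d -> R, orlicz_space d Q h /\
    ~ (L1_norm (fun x => mixed_log_mean_diag B n h x - h x) @[n --> \oo] --> 0%E).
Proof.
move=> B0 hLQ; set b := #|B|.
have b0 : (0 < b)%N by rewrite card_gt0.
have mC := @measurable_cube R d.
(* The factor $4^{l+1}$ outgrows the weight $2^{-(l+1)}$ of the series, and $A \ge 4^{l+1}$ ensures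
   [c l <= 1]. *)
have /choice[A_ hA] : forall l, exists A, (4 ^ l.+1 <= A)%N /\
    (\int[mu]_(x in cube R d) (Q `|4 ^+ l.+1 / A%:R ^+ b * D A x|)%:E <= 1)%E.
  move=> l; have [|A] := exists_cheap_dirichlet_tensor hQ
    (M := 4 ^+ l.+1) (4 ^ l.+1)%N B0 hLQ.
    by rewrite exprn_gt0.
  by exists A.
pose c l : R := 4 ^+ l.+1 / (A_ l)%:R ^+ b.
have A4 l : (4 : R) ^+ l.+1 <= (A_ l)%:R.
  by rewrite -natrX ler_nat; have [] := hA l.
have A1 l : (1 : R) <= (A_ l)%:R.
  by apply: le_trans (A4 l); rewrite exprn_ege1//; lra.
have c01 l : 0 <= c l <= 1.
  rewrite divr_ge0 ?exprn_ge0//= ler_pdivrMr ?mul1r ?exprn_gt0//.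
    by apply: le_trans (A4 l) _; apply: ler_eXnr.
  exact: lt_le_trans (A1 l).
have [h [Qh L1h hc]] := exists_orlicz_series c01 (fun l => (hA l).2).
exists h; split => // /fine_cvgP[hfin].
move=> /cvgr_lt /(_ 1 ltr01) hlt.
have [N _ hN] : \forall n \near \oo,
    (L1_norm (fun x => mixed_log_mean_diag B n h x - h x)%R < 1)%E.
  by near=> n; rewrite -(@fineK _ (L1_norm _)) ?lte_fin; near: n.
(* Here [l > N] gives [n >= N], and [l > 7 * b] gives $2^{l+1} > 2 \cdot 128^b$. *)
pose l := (N + 7 * b).+1%N; pose n := osc_index (A_ l).
have A2 : (l.+1 < A_ l)%N.
  have [Al _] := hA l; apply: leq_trans Al.
  by apply: leq_trans (ltn_expl l.+1 (_ : 1 < 4)%N) _.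
have nN : (N <= n)%N.
  rewrite /n; case: (A_ l) A2 => // A; rewrite ltnS => lA.
  by apply: leq_trans (ltnW (osc_index_gt A)); move: lA; rewrite /l; lia.
have Tlow : ((2 ^+ l.+1 / 128 ^+ b)%:E <= L1_norm (mixed_log_mean_diag B n h))%E.
  apply: le_trans (L1_mixed_log_mean_ge (c := 2 ^- l.+1 * c l) _ _ (hc l)); last 2 first.
  - exact: leq_trans A2.
  - by rewrite mulr_ge0 ?invr_ge0 ?exprn_ge0//; case/andP: (c01 l).
  rewrite lee_fin le_eqVlt; apply/orP; left; apply/eqP.
  rewrite /c expr_div_n -/b (_ : (4 : R) = 2 * 2) ?exprMn; last by lra.
  field; rewrite !expf_neq0//=.
  by rewrite gt_eqF// (lt_le_trans ltr01 (A1 l)).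
have mT : measurable_fun (cube R d) (mixed_log_mean_diag B n h).
  apply: (@measurable_dyadic_step _ _ (A_ l).*2).
  exact/dyadic_step_mixed_log_mean/ltnW/osc_index_lt.
have mh : measurable_fun (cube R d) h by case: Qh.
have Thigh : (L1_norm (mixed_log_mean_diag B n h) <= 1 + 1)%E.
  apply: (@le_trans _ _ (L1_norm (fun x => mixed_log_mean_diag B n h x - h x)%R +
                         L1_norm h)%E); last first.
    by apply: leeD => //; apply/ltW/hN.
  have mB : measurable_fun (cube R d) (fun x => (`|mixed_log_mean_diag B n h x - h x|)%:E).
    by apply/measurable_EFinP/measurableT_comp => //; exact: measurable_funB.
  have mh' : measurable_fun (cube R d) (fun x => (`|h x|)%:E).
    by apply/measurable_EFinP/measurableT_comp.
  rewrite /L1_norm -ge0_integralD//; apply: ge0_le_integral => //.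
  - by apply/measurable_EFinP/measurableT_comp.
  - exact: emeasurable_funD.
  move=> x _; rewrite -EFinD lee_fin.
  by rewrite -{1}(subrK (h x) (mixed_log_mean_diag B n h x)) ler_normD.
have := le_trans Tlow Thigh; rewrite -EFinD lee_fin ler_pdivrMr ?exprn_gt0//.
apply/negP; rewrite -ltNge.
have -> : (128 : R) = 2 ^+ 7 by rewrite !exprS expr0; lra.
rewrite -exprM (_ : 1 + 1 = 2 :> R) -?exprS; last by lra.
by rewrite ltr_eXn2l ?ltr1n// /l; lia.
Unshelve. all: by end_near.
Qed.

End walsh_divergence.

Theorem theorem3 (R : realType) (d : nat) (hd : (1 <= d)%N)
    (B : {set 'I_d}) (hB : B != finset.set0)
    (Q : R -> R) (hQ : young_function Q)
    (hLQ : ~ (orlicz_space d Q `<=` llog_space d #|B|%:R)) :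
  (ereal_sup [set op_norm Q (@mixed_log_mean_diag R d B n) |
              n in [set n : nat | (2 <= n)%N]] = +oo)%E
  /\
  (exists f : tupleR R d -> R, orlicz_space d Q f /\
     ~ (L1_norm (fun x => mixed_log_mean_diag B n f x - f x) @[n --> \oo]
          --> 0%E)).
Proof.
by split; [exact: op_norm_mixed_log_mean_unbounded|
           exact: exists_divergent_mixed_log_mean].
Qed.
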